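(* Let $G$ be an amenable discrete infinite countable group. Then there exist a standard probability space $(X,\mathfrak{B},\mu)$ and a measure-preserving action $T=(T_g)_{g\in G}$ of $G$ on $(X,\mathfrak{B},\mu)$ such that $T$ is free, $T$ is mixing, and the Kolmogorov–Sinai entropy of $T$ is zero, i.e. $h(T)=0$.
   Context: A measure-preserving action $T=(T_g)_{g\in G}$ of a countable discrete group $G$ on a standard probability space $(X,\mathfrak{B},\mu)$ is a family of invertible measurable $\mu$-preserving transformations $T_g$ of $X$ with $T_gT_h=T_{gh}$ for all $g,h\in G$ and $T_1=\mathrm{id}$. The action is free if $\mu(\{x\in X : T_gx=x\})=0$ for every $g\in G\setminus\{1\}$. The action is mixing if $\mu(T_gA\cap B)\to\mu(A)\mu(B)$ as $g\to\infty$ in $G$ (i.e. as $g$ leaves every finite subset of $G$) for all measurable subsets $A,B\subset X$. Entropy is the Kolmogorov–Sinai entropy for actions of amenable groups (Ornstein–Weiss). For a finite measurable partition $P$ of $X$, let $H(P)=-\sum_{A\in P}\mu(A)\log\mu(A)$ (with $0\log 0=0$). Let $(F_n)_{n\ge 1}$ be a Følner sequence in $G$, i.e. a sequence of nonempty finite subsets with $\#(gF_n\triangle F_n)/\#F_n\to 0$ for each $g\in G$. Put $$h(T,P)=\lim_{n\to\infty}\frac{1}{\#F_n}H\Big(\bigvee_{g\in F_n}T_g^{-1}P\Big),$$ where the limit exists and does not depend on the choice of the Følner sequence, and $h(T)=\sup_P h(T,P)$, the supremum being over all finite measurable partitions $P$ of $X$. *)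

(* Defs.v *)
From HB Require Import structures.
From mathcomp Require Import all_boot all_order all_algebra finmap.
From mathcomp Require Import all_classical all_reals all_analysis.

Set Implicit Arguments.
Unset Strict Implicit.
Unset Printing Implicit Defensive.

Import Order.TTheory GRing.Theory Num.Theory.
Import numFieldNormedType.Exports.

Local Open Scope classical_set_scope.
Local Open Scope ring_scope.

(** ** Amenable groups *)

Definition ltranslate (G : groupType) (g : G) (A : {fset G}) : {fset G} :=
  [fset (g * x)%g | x in A]%fset.

Definition fsymdiff (G : groupType) (A B : {fset G}) : {fset G} :=
  ((A `\` B) `|` (B `\` A))%fset.


Definition folner (R : realType) (G : groupType) (F : nat -> {fset G}) : Prop :=
  (forall n, F n != fset0) /\
  forall g : G,
    (#|` fsymdiff (ltranslate g (F n)) (F n)|%:R / #|` F n|%:R : R)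
      @[n --> \oo] --> (0 : R).

(* For countable discrete groups, amenability in the sense of Folner. *)
Definition amenable (R : realType) (G : groupType) : Prop :=
  exists F : nat -> {fset G}, folner R F.

(** ** Standard Borel spaces *)

(* A Polish space, presented with a complete metric: a Hausdorff
   pseudometric space is metric. *)
Definition polish (R : realType) (Y : completePseudoMetricType R) : Prop :=
  hausdorff_space Y /\ exists2 D : set Y, countable D & dense D.

Definition standard_borel (R : realType) (d : measure_display)
    (X : measurableType d) : Prop :=
  exists (Y : completePseudoMetricType R) (f : X -> Y),
    [/\ polish Y, bijective f &
        forall A : set X, measurable A <-> <<s @open Y >> (f @` A)].

(** ** Measure-preserving actions *)

Definition mp_automorphism (R : realType) (d : measure_display)
    (X : measurableType d) (mu : probability X R) (f : X -> X) : Prop :=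
  [/\ measurable_fun setT f,
      exists f' : X -> X,
        [/\ cancel f f', cancel f' f & measurable_fun setT f'] &
      forall A : set X, measurable A -> mu (f @^-1` A) = mu A].

Definition mp_action (R : realType) (G : groupType) (d : measure_display)
    (X : measurableType d) (mu : probability X R) (T : G -> X -> X) : Prop :=
  [/\ forall g : G, mp_automorphism mu (T g),
      forall g h : G, T g \o T h = T (g * h)%g &
      T 1%g = id].

(* [negligible], because [mu] carries no information on sets that are not
   measurable; in a standard Borel space the set of fixed points is
   measurable, and this says that its measure is 0. *)
Definition free_action (R : realType) (G : groupType) (d : measure_display)
    (X : measurableType d) (mu : probability X R) (T : G -> X -> X) : Prop :=
  forall g : G, g <> 1%g -> mu.-negligible [set x | T g x = x].

(* [frechet_filter] is the filter of cofinite sets, so this is the limit as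
   [g] leaves every finite subset of [G]. *)
Definition mixing (R : realType) (G : groupType) (d : measure_display)
    (X : measurableType d) (mu : probability X R) (T : G -> X -> X) : Prop :=
  forall A B : set X, measurable A -> measurable B ->
    mu ((T g @` A) `&` B) @[g --> (@frechet_filter G : set_system G)] --> (mu A * mu B)%E.

(** ** Kolmogorov-Sinai entropy *)

(* A finite family of sets with finite index type [I]; a zero measure
   contributes 0 because [0 * ln 0 = 0]. *)
Definition shannon (R : realType) (d : measure_display) (X : measurableType d)
    (mu : probability X R) (I : finType) (P : I -> set X) : R :=
  - \sum_(i : I) fine (mu (P i)) * ln (fine (mu (P i))).

Definition measurable_partition (d : measure_display) (X : measurableType d)
    (k : nat) (P : 'I_k -> set X) : Prop :=
  classical_sets.partition [set: 'I_k] P [set: X] /\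
  forall i, measurable (P i).

(* The join of the partitions T_g^{-1} P over g in F. Its cells are indexed by
   the choice of a cell of P for each g; some of them may be empty, which does
   not affect [shannon]. *)
Definition join_preimages (G : groupType) (X : Type) (T : G -> X -> X)
    (F : {fset G}) (k : nat) (P : 'I_k -> set X) (a : {ffun F -> 'I_k}) :
    set X :=
  \bigcap_(g in [set: F]) (T (val g) @^-1` P (a g)).

Definition mean_entropy (R : realType) (G : groupType) (d : measure_display)
    (X : measurableType d) (mu : probability X R) (T : G -> X -> X)
    (F : nat -> {fset G}) (k : nat) (P : 'I_k -> set X) (n : nat) : R :=
  shannon mu (join_preimages T (F := F n) P) / #|` F n|%:R.

(* h(T, P) computed along F. [lim] is only meaningful when the sequence
   converges, see [has_partition_entropies]. *)
Definition partition_entropy (R : realType) (G : groupType)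
    (d : measure_display) (X : measurableType d) (mu : probability X R)
    (T : G -> X -> X) (F : nat -> {fset G}) (k : nat) (P : 'I_k -> set X) : R :=
  limn (mean_entropy mu T F P).

Definition has_partition_entropies (R : realType) (G : groupType)
    (d : measure_display) (X : measurableType d) (mu : probability X R)
    (T : G -> X -> X) (F : nat -> {fset G}) : Prop :=
  forall (k : nat) (P : 'I_k -> set X),
    measurable_partition P -> cvgn (mean_entropy mu T F P).

Definition ks_entropy (R : realType) (G : groupType) (d : measure_display)
    (X : measurableType d) (mu : probability X R) (T : G -> X -> X)
    (F : nat -> {fset G}) : \bar R :=
  ereal_sup [set h | exists (k : nat) (P : 'I_k -> set X),
    measurable_partition P /\ h = (partition_entropy mu T F P)%:E].

(* Main.v *)
From HB Require Import structures.
From mathcomp Require Import all_boot all_order all_algebra finmap.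
From mathcomp Require Import all_classical all_reals all_analysis.
From mathcomp Require Import zify ring lra.
Require Import Defs.

(** Zero entropy and mixing are obtained from an action that preserves an
    infinite measure and is mixing there in the sense that nu (g A /\ A) tends
    to 0, by passing to the parities of a Poisson process.

    Let G act on a space Y with an infinite invariant measure nu, and let B_0 be
    a set of measure 1 that is, for every n, the disjoint union of the
    translates s B_n, s in S_n, of one set B_n, where S_n is finite and |S_n|
    tends to infinity. Cutting and spacing gives such a situation: S_0 = {1},
    S_(n+1) = S_n C_n, and B_n is the disjoint union of the sets c B_(n+1), c in
    C_n. Scatter a Poisson process of intensity nu / 2 on Y, and let x_(n,g) be
    the parity of the number of its points in g B_n. For every finite family of
    sites i = (n, g), the expectation of the product of the signs (-1)^x_i is
    exp (- nu (D)), where D is the symmetric difference of the sets g B_n. So the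
    law of the parities is invariant under G, and everything can be read off
    from this formula.

    - Mixing. nu (D) is additive over two families of sites up to twice the
      measure of the intersections, so a family moved far away decorrelates from
      a fixed one as soon as nu (g B_0 /\ B_0) tends to 0. The cuts C_n are
      chosen so spread out that |g S_(n+1) /\ S_(n+1)| <= 2 |S_n| for g outside
      a finite set (exists_spread, overlap_decay, escaping_decorrelates).
    - Freeness. The sign product over (0, h) and (0, g^-1 h) is 1 on the fixed
      points of g, its expectation is at most exp (- 2/3), and it decorrelates
      from every event as h tends to infinity (free_shift).
    - Entropy. For M >= m, x_(m,g) is almost surely the sum modulo 2 of the
      x_(M,g d) with d in C_m ... C_(M-1). Thus the x_(m,g^-1 k) with g in F
      and k in K are determined by the bits x_(M,h), h in F^-1 K', with K' finite
      and depending only on K and M. When F is invariant enough there are at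
      most 2 |F| such bits, and each has probability at most 1 / (M+1) of being
      1, hence little entropy. An arbitrary partition is approximated by one that
      depends on finitely many sites, and the discrepancies are recorded by
      further variables that are rarely active. Subadditivity of entropy is the
      only property of entropy involved (entropy_join_le, mean_entropy_cvg0).

    The space Y is never built. At stage n the points of Y are replaced by
    independent bits z_h, h in G, with E (-1)^z_h = exp (- 1 / |S_n|), and
    x_(m,g) by the parity of the bits over g C_m ... C_(n-1). Because the cuts are
    spread out, the expectation of a given product of signs no longer depends on
    n once n is large (stage_chi_stable). The limits define a positive functional
    on functions of finitely many sites, and coding by subintervals of [0, 1)
    realises it by a probability on the space of all families of bits
    (law_finitary). *)

Set Implicit Arguments.
Unset Strict Implicit.
Unset Printing Implicit Defensive.

Import Order.TTheory GRing.Theory Num.Theory.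
Import numFieldNormedType.Exports.

Local Open Scope classical_set_scope.
Local Open Scope ring_scope.

(** * Products of finite lists in a group, and spread-out sets *)

Section Products.
Variable G : groupType.
Implicit Types (A B C S K E : seq G) (g k c : G).

Definition prods A B : seq G := [seq (a * b)%g | a <- A, b <- B].

Definition invs A : seq G := [seq (a^-1)%g | a <- A].

(** For a duplicate-free S this is the cardinal of g S /\ S. *)
Definition overlap g S := count (fun x => (g * x)%g \in S) S.

Lemma mem_prods A B a b : a \in A -> b \in B -> (a * b)%g \in prods A B.
Proof. exact: allpairs_f. Qed.

Lemma prodsP A B x :
  reflect (exists a b, [/\ a \in A, b \in B & x = (a * b)%g]) (x \in prods A B).
Proof.
apply: (iffP allpairsP) => [[[a b]] [/= ? ? ->]|[a [b [? ? ->]]]].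
  by exists a, b.
by exists (a, b).
Qed.

Lemma mem_invs A a : a \in A -> (a^-1)%g \in invs A.
Proof. exact: map_f. Qed.

Lemma prods1l A : prods [:: 1%g] A = A.
Proof. by rewrite /prods allpairs1l -[RHS]map_id; apply: eq_map => x; rewrite mul1g. Qed.

Lemma prods1r A : prods A [:: 1%g] = A.
Proof. by rewrite /prods allpairs1r -[RHS]map_id; apply: eq_map => x; rewrite mulg1. Qed.

Lemma prods_map A B g : [seq (g * x)%g | x <- prods A B] = prods [seq (g * x)%g | x <- A] B.
Proof.
rewrite /prods map_allpairs allpairs_mapl; by apply: eq_allpairs => x y; rewrite mulgA.
Qed.

Lemma prods_cons A B a : prods (a :: A) B = [seq (a * x)%g | x <- B] ++ prods A B.
Proof. by []. Qed.

Lemma prods_cat A B C : prods (A ++ B) C = prods A C ++ prods B C.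
Proof. exact: allpairs_cat. Qed.

Lemma prodsA A B C : prods A (prods B C) = prods (prods A B) C.
Proof.
by elim: A => // a A IH; rewrite !prods_cons prods_cat prods_map IH.
Qed.

Lemma size_prods A B : size (prods A B) = (size A * size B)%N.
Proof. exact: size_allpairs. Qed.

Lemma uniq_prods A B :
  uniq A -> uniq B ->
  (forall a a' b b', a \in A -> a' \in A -> b \in B -> b' \in B ->
     (a * b = a' * b')%g -> b = b') -> uniq (prods A B).
Proof.
move=> uA uB inj; apply: allpairs_uniq => // -[a b] [a' b'].
move=> /allpairsP[[? ?] [/= ? ? [-> ->]]] /allpairsP[[? ?] [/= ? ? [-> ->]]] e.
have := inj _ _ _ _ _ _ _ _ e => eb; rewrite eb // in e *.
by rewrite (mulIg _ _ _ e).
Qed.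

Lemma overlap_perm g S S' : perm_eq S S' -> overlap g S = overlap g S'.
Proof.
move=> pS; rewrite /overlap (permP pS); apply: eq_count => x.
by rewrite (perm_mem pS).
Qed.

Lemma overlap_eq0 g S : g \notin prods S (invs S) -> overlap g S = 0%N.
Proof.
move=> gS; apply/eqP; rewrite -leqn0 leqNgt -has_count; apply: contra gS.
case/hasP => x xS gxS; rewrite -[g](mulgK x) mem_prods ?mem_invs //.
Qed.

Lemma exists_notin (Ginf : infinite_set [set: G]) A : exists c, c \notin A.
Proof.
apply: contrapT => /forallNP h; apply: Ginf.
apply: (@sub_finite_set _ _ [set` A]); last exact: finite_seq.
by move=> x _ /=; apply/negPn/negP/h.
Qed.

(** The bound does not grow with U. If g maps some element of U into U, then c is
    too far from U for the new elements s c to take part in the overlap; if not,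
    every coincidence g x = y has x or y among the |S| new elements. *)
Lemma overlap_adjoin g c S U :
  uniq S -> uniq U ->
  g \notin prods S (invs S) ->
  c \notin prods (invs S) (prods (prods U (invs U)) U) ->
  (overlap g U <= 2 * size S)%N ->
  (overlap g ([seq (s * c)%g | s <- S] ++ U) <= 2 * size S)%N.
Proof.
move=> uS uU gS cU ovU; set V := map _ S.
have sV : size V = size S by rewrite size_map.
rewrite /overlap count_cat.
case: (boolP (g \in prods U (invs U))) => gU.
  have gU' : (g^-1)%g \in prods U (invs U).
    case/prodsP : gU => a [b [aU /mapP[b' b'U ->] ->]].
    by rewrite invgM invgK mem_prods // mem_invs.
  rewrite (_ : count _ V = 0)%N ?add0n.
    apply: leq_trans ovU; rewrite leq_eqVlt; apply/orP; left; apply/eqP.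
    apply: eq_in_count => x xU; rewrite mem_cat orbC.
    case: (boolP (_ \in U)) => //= _; apply/negP => /mapP[s sS e]; case/negP: cU.
    by rewrite -[c](mulKg s) -e mem_prods ?mem_invs // mem_prods.
  apply/eqP; rewrite -leqn0 leqNgt -has_count; apply/negP => /hasP[x /mapP[s sS ->]].
  rewrite mem_cat => /orP[/mapP[s' s'S]|gscU].
    rewrite mulgA => /mulIg e; case/negP: gS.
    by rewrite -[g](mulgK s) e mem_prods ?mem_invs.
  case/negP: cU; rewrite -[c](mulKg s) -[(s * c)%g](mulKg g) mem_prods ?mem_invs //.
  exact: mem_prods.
rewrite mul2n -addnn leq_add //; first by rewrite -sV count_size.
rewrite -size_filter -sV -(size_map (fun x => (g * x)%g)) uniq_leq_size //.
  by rewrite map_inj_uniq ?filter_uniq //; exact: mulgI.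
move=> _ /mapP[x + ->]; rewrite mem_filter mem_cat => /andP[/orP[//|gxU] xU].
by case/negP: gU; rewrite -[g](mulgK x) mem_prods ?mem_invs.
Qed.

(** The elements of C are chosen one at a time, each outside a finite set that
    depends on the previous ones. *)
Lemma exists_spread (Ginf : infinite_set [set: G]) S K r :
  uniq S -> {subset S <= K} ->
  exists C, [/\ size C = r.+1, 1%g \in C, uniq C,
    forall k k' c c', k \in K -> k' \in K -> c \in C -> c' \in C ->
      (k * c = k' * c')%g -> c = c' &
    forall g, g \notin prods S (invs S) ->
      (overlap g (prods S C) <= 2 * size S)%N].
Proof.
move=> uS SK; elim: r => [|r [C [sC C1 uC injC ovC]]].
  exists [:: 1%g]; split; rewrite ?mem_head //.
    by move=> k k' c c' _ _; rewrite !inE => /eqP-> /eqP->.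
  by move=> g gS; rewrite prods1r overlap_eq0.
set U := prods S C.
have [c] := exists_notin Ginf (C ++ prods (prods (invs K) K) C ++
   prods (invs S) (prods (prods U (invs U)) U)).
rewrite !mem_cat => /norP[cC /norP[cK cU]].
have key k k' c' : k \in K -> k' \in K -> c' \in C -> (k * c != k' * c')%g.
  move=> kK k'K c'C; apply: contra cK => /eqP e.
  by rewrite -[c](mulKg k) e mulgA mem_prods // mem_prods // mem_invs.
exists (c :: C); split=> /=; rewrite ?sC ?in_cons ?C1 ?orbT ?cC //.
- move=> k k' c1 c2 kK k'K; rewrite !in_cons.
  move=> /predU1P[->|c1C] /predU1P[->|c2C] // e.
  + by move/eqP: (key k k' c2 kK k'K c2C).
  + by move/eqP: (key k' k c1 k'K kK c1C); rewrite e.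
  + exact: injC e.
- move=> g gS; rewrite (@overlap_perm _ _ ([seq (s * c)%g | s <- S] ++ U)); last first.
    exact/permPl/(perm_allpairs_consr (fun x y => (x * y)%g)).
  apply: overlap_adjoin => //; last exact: ovC.
  apply: uniq_prods => // a a' b b' aS a'S; apply: injC; exact: SK.
Qed.

End Products.

(** * Multiplicities modulo 2 *)

Section Multiplicity.

Lemma count_prods (G : groupType) (p q : pred G) (A C : seq G) :
  (forall a c, a \in A -> c \in C -> p (a * c)%g = q a) ->
  count p (prods A C) = (count q A * size C)%N.
Proof.
elim: A => //= a A IH h; rewrite prods_cons count_cat IH; last first.
  by move=> a' c a'A; apply: h; rewrite in_cons a'A orbT.
rewrite mulnDl; congr addn; rewrite count_map.
rewrite (@eq_in_count _ _ (fun=> q a)); last by move=> c cC /=; apply: h; rewrite ?mem_head.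
by case: (q a); rewrite ?mul1n ?mul0n; [exact: count_predT|exact: count_pred0].
Qed.

Variable T : eqType.
Implicit Types u v w : seq T.

(** The set of elements of odd multiplicity is the sum of the singletons modulo 2,
    so this is the cardinal of an iterated symmetric difference. *)
Definition odds u := count (fun x => odd (count_mem x u)) (undup u).

Definition common u v := count (mem v) (undup u).

Lemma odds_count u w : uniq w -> {subset u <= w} ->
  odds u = count (fun x => odd (count_mem x u)) w.
Proof.
move=> uw uw'; rewrite /odds -!size_filter; apply/perm_size/uniq_perm.
- by rewrite filter_uniq ?undup_uniq.
- by rewrite filter_uniq.
move=> x; rewrite !mem_filter mem_undup; case: (boolP (x \in u)) => [/uw'->//|].
by move=> /count_memPn ->.
Qed.

Lemma common_catl u u' v : (common (u ++ u') v <= common u v + common u' v)%N.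
Proof.
rewrite /common -!size_filter -size_cat uniq_leq_size ?filter_uniq ?undup_uniq //.
move=> x; rewrite mem_filter mem_cat !mem_filter !mem_undup mem_cat.
by rewrite /= -andb_orr.
Qed.

Lemma common_catr u v v' : (common u (v ++ v') <= common u v + common u v')%N.
Proof.
rewrite /common -!size_filter -size_cat uniq_leq_size ?filter_uniq ?undup_uniq //.
move=> x; rewrite mem_filter mem_cat !mem_filter !mem_undup /= mem_cat.
by rewrite -andb_orl.
Qed.

Lemma common_nilr u : common u [::] = 0%N.
Proof. by rewrite /common (@eq_count _ _ pred0) ?count_pred0. Qed.

(** The elements of odd multiplicity in a concatenation form the symmetric
    difference of those of the two parts. *)
Lemma odds_cat u v :
  (odds (u ++ v) <= odds u + odds v <= odds (u ++ v) + 2 * common u v)%N.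
Proof.
set w := undup (u ++ v); have uw : uniq w by exact: undup_uniq.
rewrite (@odds_count u w) ?(@odds_count v w) ?(@odds_count (u ++ v) w) //; first last.
- by move=> x xu; rewrite mem_undup mem_cat xu.
- by move=> x xu; rewrite mem_undup mem_cat xu orbT.
- by move=> x; rewrite mem_undup.
have -> : common u v = count (fun x => (x \in u) && (x \in v)) w.
  rewrite /common -!size_filter; apply/perm_size/uniq_perm.
  - by rewrite filter_uniq ?undup_uniq.
  - by rewrite filter_uniq.
  move=> x; rewrite !mem_filter !mem_undup mem_cat /=.
  by case: (x \in u); case: (x \in v).
elim: w {uw} => //= x w /andP[IH1 IH2].
rewrite count_cat oddD -!(has_pred1 x); move: (has_count (pred1 x) u) (has_count (pred1 x) v).
rewrite !has_pred1 => -> ->.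
case: (count_mem x u) => [|nu]; case: (count_mem x v) => [|nv] //=; try lia;
case: (odd _) => /=; try case: (odd _) => /=; lia.
Qed.

Lemma odds_uniq u : uniq u -> odds u = size u.
Proof.
move=> uu; rewrite /odds undup_id // -size_filter (_ : seq.filter _ u = u) //.
rewrite -[RHS]filter_predT; apply: eq_in_filter => x xu.
by rewrite count_uniq_mem // xu.
Qed.

Lemma odds_double u : odds (u ++ u) = 0%N.
Proof.
rewrite /odds (@eq_count _ _ pred0) ?count_pred0 // => x /=.
by rewrite count_cat addnn odd_double.
Qed.

End Multiplicity.

Lemma odds_map_inj (T T' : eqType) (h : T -> T') (u : seq T) : injective h ->
  odds (map h u) = odds u.
Proof.
move=> hinj; rewrite (@odds_count _ _ (map h (undup u))).
- rewrite count_map; apply: eq_count => x /=; rewrite count_map.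
  by congr odd; apply: eq_count => y /=; exact: inj_eq.
- by rewrite map_inj_uniq ?undup_uniq.
- by move=> _ /mapP[x xu ->]; rewrite map_f // mem_undup.
Qed.

(** A product k c determines c and then k, so multiplicities in prods u C are those
    in u. *)
Lemma odds_prods (G : groupType) (u C : seq G) : uniq C ->
  (forall k k' c c', k \in u -> k' \in u -> c \in C -> c' \in C ->
    (k * c = k' * c')%g -> c = c') ->
  odds (prods u C) = (odds u * size C)%N.
Proof.
move=> uC inj.
have cnt k c : k \in u -> c \in C -> count_mem (k * c)%g (prods u C) = count_mem k u.
  move=> ku cC.
  have : {subset u <= u} by [].
  rewrite {1 3 4}(lock u); elim: (locked u) => // a A IH Au.
  rewrite prods_cons count_cat IH /=; last by move=> x xA; rewrite Au // in_cons xA orbT.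
  congr addn; rewrite count_map /=.
  rewrite (@eq_in_count _ _ (fun x => (a == k) && (x == c))).
    by case: eqP => _; rewrite ?count_pred0 //= count_uniq_mem // cC.
  move=> x xC /=; apply/eqP/andP => [e|[/eqP-> /eqP->]//].
  have xc : x = c by apply: inj e => //; apply: Au; rewrite mem_head.
  by move: e; rewrite xc => /mulIg ->; rewrite !eqxx.
rewrite (@odds_count _ _ (prods (undup u) C)).
- rewrite (@count_prods _ _ (fun k => odd (count_mem k u))) // => a c.
  by rewrite mem_undup => au cC; rewrite cnt.
- apply: uniq_prods; rewrite ?undup_uniq // => a a' b b'; rewrite !mem_undup; exact: inj.
- by move=> x /prodsP[a [b [au bC ->]]]; rewrite mem_prods // mem_undup.
Qed.

(** * The tower of cuts *)

Section Tower.
Variable G : groupType.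

(** levels C m n is C_m C_(m+1) ... C_(n-1), and {1} when n <= m. *)
Fixpoint levels (C : nat -> seq G) (m n : nat) : seq G :=
  if n is n'.+1 then
    if (m <= n')%N then prods (levels C m n') (C n') else [:: 1%g]
  else [:: 1%g].

(** cuts n is the set C_n and levels cuts 0 n the set S_n of the construction.
    By cuts_spread, the translates of S_n by the elements of C_n stay disjoint even
    after motions in window n. Outside window n, overlap_escape bounds the
    fraction of S_(n+1) that a translation keeps inside S_(n+1) by 2 / (n + 3);
    window 0 is {1} so that the bound 2/3 holds for every g other than 1. *)
Record tower := Tower {
  cuts : nat -> seq G;
  window : nat -> seq G;
  size_cuts : forall n, size (cuts n) = n.+3;
  uniq_cuts : forall n, uniq (cuts n);
  cuts1 : forall n, 1%g \in cuts n;
  window0 : window 0 = [:: 1%g];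
  windowS : forall n, {subset window n <= window n.+1};
  window_exhausts : forall g, exists n, g \in window n;
  cuts_spread : forall n k k' c c',
    k \in prods (window n) (levels cuts 0 n) ->
    k' \in prods (window n) (levels cuts 0 n) ->
    c \in cuts n -> c' \in cuts n -> (k * c = k' * c')%g -> c = c';
  overlap_escape : forall n g, g \notin window n ->
    (overlap g (levels cuts 0 n.+1) <= 2 * size (levels cuts 0 n))%N }.

(** Only elements of S_n S_n^-1 can violate overlap_escape, so the window at stage
    n has to contain them; it also receives the n-th element of the group, to
    exhaust it. *)
Lemma exists_tower (e : nat -> G) : infinite_set [set: G] ->
  (forall g, exists n, e n = g) -> inhabited tower.
Proof.
move=> Ginf e_surj.
pose spec (p : seq G * seq G * nat) (C : seq G) :=
  uniq p.1.1 -> 1%g \in p.1.2 ->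
  [/\ size C = p.2.+3, 1%g \in C, uniq C,
    forall k k' c c', k \in prods p.1.2 p.1.1 -> k' \in prods p.1.2 p.1.1 ->
      c \in C -> c' \in C -> (k * c = k' * c')%g -> c = c' &
    forall g, g \notin prods p.1.1 (invs p.1.1) ->
      (overlap g (prods p.1.1 C) <= 2 * size p.1.1)%N].
have /choice[f fP] : forall p, exists C, spec p C.
  move=> [[B E] n]; have [uS|nB] := boolP (uniq B); last first.
    by exists [::]; rewrite /spec /= => uB; rewrite uB in nB.
  have [E1|nE] := boolP (1%g \in E); last first.
    by exists [::]; rewrite /spec /= => _ E1; rewrite E1 in nE.
  have [|C CP] := @exists_spread _ Ginf B (prods E B) n.+2 uS; last by exists C.
  by move=> s sS; rewrite -[s]mul1g mem_prods.
pose st := fix st n := if n is n'.+1 then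
    let SE := st n' in let B' := prods SE.1 (f (SE, n')) in
    (B', e n' :: SE.2 ++ prods B' (invs B'))
  else ([:: 1%g], [:: 1%g]).
pose C n := f (st n, n).
have stE n : (st n).1 = levels C 0 n by elim: n => //= n ->.
have E1 n : 1%g \in (st n).2.
  by elim: n => [|n IH]; rewrite /= ?mem_head // in_cons mem_cat IH !orbT.
have uS n : uniq (st n).1.
  elim: n => // n IH; have [_ _ uC inj _] := fP (st n, n) IH (E1 n).
  apply: uniq_prods => // a a' b b' aS a'S; apply: inj.
    by rewrite -[a]mul1g mem_prods ?E1.
  by rewrite -[a']mul1g mem_prods ?E1.
have CP n : [/\ size (C n) = n.+3, 1%g \in C n, uniq (C n),
    forall k k' c c', k \in prods (st n).2 (st n).1 ->
       k' \in prods (st n).2 (st n).1 -> c \in C n -> c' \in C n ->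
      (k * c = k' * c')%g -> c = c' &
    forall g, g \notin prods (st n).1 (invs (st n).1) ->
      (overlap g (prods (st n).1 (C n)) <= 2 * size (st n).1)%N].
  exact: fP (st n, n) (uS n) (E1 n).
constructor; apply: (@Tower C (fun n => (st n).2)).
- by move=> n; have [] := CP n.
- by move=> n; have [] := CP n.
- by move=> n; have [] := CP n.
- by [].
- by move=> n g gE; rewrite /= in_cons mem_cat gE !orbT.
- by move=> g; have [n <-] := e_surj g; exists n.+1; rewrite /= mem_head.
- by move=> n; rewrite -stE; have [] := CP n.
- move=> n g gE; rewrite /= -stE; have [_ _ _ _ -> //] := CP n.
  apply: contra gE; case: n => [|n] //=.
    by rewrite /invs /= invg1 prods1l.
  by rewrite in_cons mem_cat => ->; rewrite !orbT.
Qed.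

Variable t : tower.
Local Notation D := (levels (cuts t)).
Local Notation E := (window t).
Local Notation B := (D 0%N).

Lemma level_refl m : D m m = [:: 1%g].
Proof. by case: m => //= m; rewrite ltnn. Qed.

Lemma levelS m n : (m <= n)%N -> D m n.+1 = prods (D m n) (cuts t n).
Proof. by move=> /= ->. Qed.

(** The two sides are equal as lists, and not only up to a permutation. *)
Lemma level_comp m k n : (m <= k <= n)%N -> D m n = prods (D m k) (D k n).
Proof.
move=> /andP[mk]; elim: n => [|n IH].
  rewrite leqn0 => /eqP k0; move: mk; rewrite k0 leqn0 => /eqP ->.
  by rewrite prods1l.
rewrite leq_eqVlt => /predU1P[->|]; first by rewrite level_refl prods1r.
rewrite ltnS => kn; rewrite !levelS //; last exact: leq_trans kn.
by rewrite prodsA -IH.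
Qed.

Lemma level1 m n : 1%g \in D m n.
Proof.
elim: n => [|n IH]; first by rewrite mem_head.
rewrite /=; case: ifP => _; last by rewrite mem_head.
by rewrite -[1%g]mulg1 mem_prods // cuts1.
Qed.

Lemma level_sub m n : {subset D m n <= B n}.
Proof.
elim: n => [|n IH] //= x; case: ifP => _.
  by move=> /prodsP[a [b [aD bC ->]]]; rewrite mem_prods // IH.
by rewrite inE => /eqP ->; exact: (level1 0 n.+1).
Qed.

Lemma window_mono n n' : (n <= n')%N -> {subset E n <= E n'}.
Proof.
move=> /subnK <-; elim: (n' - n)%N => [|k IH] // x xE.
by rewrite addSn windowS // IH.
Qed.

Lemma window_near g : exists N, forall n, (N <= n)%N -> g \in E n.
Proof. by have [N gN] := window_exhausts t g; exists N => n /window_mono; apply. Qed.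

Lemma window1 n : 1%g \in E n.
Proof. by apply: (window_mono (leq0n n)); rewrite window0 mem_head. Qed.

Lemma level_window n : {subset B n <= prods (E n) (B n)}.
Proof. by move=> x xS; rewrite -[x]mul1g mem_prods // window1. Qed.

Lemma level_uniq n : uniq (B n).
Proof.
elim: n => // n IH; rewrite levelS //; apply: uniq_prods => //.
  exact: uniq_cuts.
move=> a a' b b' aS a'B; apply: cuts_spread; exact: level_window.
Qed.

Lemma size_levelS m n : (m <= n)%N -> size (D m n.+1) = (size (D m n) * n.+3)%N.
Proof. by move=> mn; rewrite levelS // size_prods size_cuts. Qed.

Lemma size_level_gt0 m n : (0 < size (D m n))%N.
Proof. by have := level1 m n; case: (D m n). Qed.

Lemma size_level_comp m n : (m <= n)%N ->
  size (B n) = (size (B m) * size (D m n))%N.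
Proof. by move=> mn; rewrite (@level_comp 0 m n) ?leq0n // size_prods. Qed.

Lemma size_level_ge n : (n < size (B n))%N.
Proof.
elim: n => // n IH; rewrite size_levelS //.
have := size_level_gt0 0 n; nia.
Qed.


(** Once g lies in the window, g s c = s' c' forces c = c', so the fraction of S_n
    kept by g is the same at all later stages. *)
Lemma overlapS n g : g \in E n -> overlap g (B n.+1) = (overlap g (B n) * n.+3)%N.
Proof.
move=> gE; rewrite levelS // /overlap -(size_cuts t); apply: count_prods => a c aB cC.
apply/idP/idP => [|gaB]; last by rewrite mulgA mem_prods.
move=> /prodsP[a' [c' [a'B c'C]]]; rewrite mulgA => e.
have cc : c = c'.
  by apply: (cuts_spread _ _ cC c'C e); [exact: mem_prods|exact: level_window].
by move: e; rewrite cc => /mulIg ->.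
Qed.

(** Let j + 1 be the first stage whose window contains g, so that m <= j. The
    overlap at that stage is at most 2 |S_j|, a fraction 2 / (j + 3) of |S_(j+1)|,
    and by overlapS this fraction does not change afterwards. *)
Lemma overlap_decay m g : g \notin E m -> exists N, forall n, (N <= n)%N ->
  (overlap g (B n) * m.+3 <= 2 * size (B n))%N.
Proof.
move=> gE; have ex := window_exhausts t g.
case: (ex_minnP ex) => j gEj jmin.
have mj : (m < j)%N by rewrite ltnNge; apply: contra gE => /window_mono; apply.
case: j gEj jmin mj => // j gEj jmin; rewrite ltnS => mj.
have gEj' : g \notin E j by apply/negP => /jmin; rewrite ltnn.
exists j.+1 => n /subnK <-; elim: (n - j.+1)%N => [|k IH].
  rewrite add0n size_levelS //; have := overlap_escape gEj'; nia.
rewrite addSn overlapS ?size_levelS //; first by nia.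
by apply: window_mono gEj; rewrite leq_addl.
Qed.

Lemma level_uniq_gen m n : uniq (D m n).
Proof.
have [mn|nm] := leqP m n.
  have := level_uniq n; rewrite (@level_comp 0 m n) ?leq0n //.
  have := level1 0 m; case: (D 0 m) => // b s _; rewrite prods_cons cat_uniq.
  by move=> /andP[]; rewrite map_inj_uniq //; exact: mulgI.
by case: n nm => //= n nm; rewrite leqNgt ltnW.
Qed.

Implicit Types (i j : nat * G) (l : seq (nat * G)).

(** A site (m, g) stands for the set g B_m of the infinite measure space, which at
    stage n is the disjoint union of the g d B_n; the latter are recorded by the
    elements g d. *)
Definition expand n l : seq G := [seq (i.2 * d)%g | i <- l, d <- D i.1 n].

Lemma expand_cons n i l :
  expand n (i :: l) = [seq (i.2 * d)%g | d <- D i.1 n] ++ expand n l.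
Proof. by []. Qed.

Lemma expand_cat n l l' : expand n (l ++ l') = expand n l ++ expand n l'.
Proof. exact: allpairs_cat. Qed.

Lemma expandS n l : all (fun i => i.1 <= n)%N l ->
  expand n.+1 l = prods (expand n l) (cuts t n).
Proof.
elim: l => // i l IH /andP[il /IH e]; rewrite !expand_cons e prods_cat levelS //.
by rewrite prods_map.
Qed.

Lemma expand_refine m k n g : (m <= k <= n)%N ->
  expand n [:: (m, g)] = expand n [seq (k, g * d)%g | d <- D m k].
Proof.
move=> mkn; rewrite /expand /= cats0 (level_comp mkn).
by rewrite allpairs_mapl /= prods_map /prods allpairs_mapl.
Qed.

Lemma expand_window n l : all (fun i => i.2 \in E n) l ->
  {subset expand n l <= prods (E n) (B n)}.
Proof.
move=> /allP lE x /allpairsPdep[i [d [il dD ->]]]; apply: mem_prods; first exact: lE.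
exact: level_sub dD.
Qed.

Lemma expand_translate n g l :
  expand n [seq (i.1, g * i.2)%g | i <- l] = [seq (g * x)%g | x <- expand n l].
Proof.
rewrite /expand allpairs_mapl map_allpairs; apply: eq_allpairs => i d /=.
by rewrite mulgA.
Qed.

(** Both the number of odd elements and |S_n| are multiplied by |C_n|, so their
    quotient, the measure of the symmetric difference of the sets of l, is
    independent of the stage. *)
Lemma odds_expandS n l : all (fun i => i.1 <= n)%N l -> all (fun i => i.2 \in E n) l ->
  odds (expand n.+1 l) = (odds (expand n l) * n.+3)%N.
Proof.
move=> ln lE; rewrite expandS // odds_prods ?size_cuts ?uniq_cuts //.
by move=> k k' c c' /(expand_window lE) kl /(expand_window lE) k'l; apply: cuts_spread kl k'l.
Qed.

(** The pieces common to two sites lie in k (k^-1 g S_n /\ S_n), because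
    C_m ... C_(n-1) is contained in S_n. *)
Lemma common_expand n l l' :
  (common (expand n l) (expand n l') <=
   \sum_(i <- l) \sum_(j <- l') overlap (j.2^-1 * i.2)%g (B n))%N.
Proof.
elim: l => [|i l IH]; first by rewrite big_nil.
rewrite expand_cons big_cons; apply: leq_trans (common_catl _ _ _) _.
apply: leq_add IH; elim: l' => [|j l' IH]; first by rewrite big_nil leqn0; apply/eqP/common_nilr.
rewrite expand_cons big_cons; apply: leq_trans (common_catr _ _ _) _.
apply: leq_add IH; rewrite /common undup_id; last first.
  by rewrite map_inj_uniq ?level_uniq_gen //; exact: mulgI.
rewrite count_map /overlap -!size_filter uniq_leq_size //.
  by rewrite filter_uniq // level_uniq_gen.
move=> x; rewrite !mem_filter /= => /andP[/mapP[y yD e] xD].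
rewrite (level_sub xD) andbT -mulgA e mulKg; exact: level_sub yD.
Qed.

End Tower.

(** * Functions of finitely many bits *)

Section Finitary.
Variable A : eqType.

Definition depends_on J (s : seq A) (f : (A -> bool) -> J) :=
  forall x y, {in s, x =1 y} -> f x = f y.

Definition finitary J (f : (A -> bool) -> J) := exists s, depends_on s f.

Lemma finitary_cst J (c : J) : finitary (fun=> c).
Proof. by exists [::]. Qed.

Lemma finitary_coord (i : A) : finitary (fun x => x i).
Proof. by exists [:: i] => x y; apply; rewrite mem_head. Qed.

Lemma finitary1 J K (op : J -> K) f : finitary f -> finitary (fun x => op (f x)).
Proof. by move=> [s df]; exists s => x y xy; rewrite (df x y). Qed.

Lemma finitary2 J K M (op : J -> K -> M) f g :
  finitary f -> finitary g -> finitary (fun x => op (f x) (g x)).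
Proof.
move=> [s df] [s' dg]; exists (s ++ s') => x y xy.
by rewrite (df x y) ?(dg x y) // => i si; apply: xy; rewrite mem_cat si ?orbT.
Qed.

Lemma finitary_natr (R : realType) (v : (A -> bool) -> bool) :
  finitary v -> finitary (fun x => (v x)%:R : R).
Proof. exact: (finitary1 (fun c : bool => c%:R)). Qed.

Definition upd (x : A -> bool) i (b : bool) : A -> bool := fun j => if j == i then b else x j.

End Finitary.

Section RandomBits.
Variables (R : realType) (A : eqType).
Implicit Types (z : A -> bool) (f g : (A -> bool) -> R) (l s : seq A) (D : seq A).

(** The characters of the group of families of bits. *)
Definition chi l z : R := (-1) ^+ count z l.

Lemma chi_nil z : chi [::] z = 1. Proof. by []. Qed.

Lemma chi_cons i l z : chi (i :: l) z = (-1) ^+ z i * chi l z.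
Proof. by rewrite /chi /= exprD. Qed.

Lemma chi_cat l l' z : chi (l ++ l') z = chi l z * chi l' z.
Proof. by rewrite /chi count_cat exprD. Qed.

Definition flip (a : A) z : A -> bool := fun x => z x (+) (x == a).

Lemma chi_flip l a z : chi l (flip a z) = (-1) ^+ odd (count_mem a l) * chi l z.
Proof.
rewrite signr_odd; elim: l => [|i l IH]; first by rewrite !chi_nil mulr1.
rewrite !chi_cons IH /= exprD /flip signr_addb; ring.
Qed.

Variable sign_mean : R.
Hypothesis sign_mean01 : 0 <= sign_mean <= 1.

(** The expectation of f at a random family of bits: those indexed by D are
    independent, with (-1)^bit of expectation sign_mean, and the others are 0.
    Conditioning on the bit at a amounts to flipping it or not. *)
Fixpoint expect_bits D f : R :=
  if D is a :: D' then
    (1 + sign_mean) / 2 * expect_bits D' f + (1 - sign_mean) / 2 * expect_bits D' (f \o flip a)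
  else f (fun=> false).

Lemma expect_bits_linear D f g a b :
  expect_bits D (fun z => a * f z + b * g z) = a * expect_bits D f + b * expect_bits D g.
Proof.
elim: D f g => // d D IH f g /=; rewrite IH.
rewrite (_ : _ \o flip d = fun z => a * (f \o flip d) z + b * (g \o flip d) z) //.
rewrite IH; ring.
Qed.

Lemma expect_bits_ge0 D f : (forall z, 0 <= f z) -> 0 <= expect_bits D f.
Proof.
move: sign_mean01 => /andP[t0 t1].
elim: D f => [f f0|d D IH f f0] /=; first exact: f0.
by rewrite addr_ge0 // mulr_ge0 ?IH //; try lra; move=> z /=.
Qed.

(** Each place of odd multiplicity contributes a factor sign_mean, each other one
    the square of a sign. *)
Lemma expect_bits_chi D l : uniq D -> {subset l <= D} ->
  expect_bits D (chi l) = sign_mean ^+ odds l.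
Proof.
move=> uD lD; rewrite (odds_count uD lD) => {uD lD}.
elim: D => [|d D IH] /=; first by rewrite /chi (@eq_count _ _ pred0) ?count_pred0.
rewrite (_ : _ \o flip d =
  fun z => (-1) ^+ odd (count_mem d l) * chi l z + 0 * chi l z); last first.
  by apply/funext => z /=; rewrite chi_flip mul0r addr0.
rewrite expect_bits_linear IH exprD.
by case: (odd _) => /=; rewrite ?expr1 ?expr0; field.
Qed.

(** Characters span the functions of finitely many bits. *)
Lemma depends_ind (P : ((A -> bool) -> R) -> Prop) :
  (forall l, P (chi l)) ->
  (forall a b f g, P f -> P g -> P (fun x => a * f x + b * g x)) ->
  forall s f, depends_on s f -> P f.
Proof.
move=> Pchi Plin.
(* The factor chi l absorbs the sign of the coordinate that is split off. *)
have gen s : forall f, depends_on s f -> forall l, P (fun x => chi l x * f x).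
  elim: s => [|i s IH] f df l.
    rewrite (_ : (fun _ => _) = fun x => f (fun=> false) * chi l x + 0 * chi l x).
      exact: Plin.
    by apply/funext => x; rewrite mul0r addr0 mulrC; congr (_ * _); exact: df.
  pose fb b x := f (upd x i b).
  have dfb b : depends_on s (fb b).
    move=> x y xy; apply: df => j; rewrite in_cons /upd.
    by case: eqP => //= _; exact: xy.
  rewrite (_ : (fun _ => _) = fun x =>
     1 * (2^-1 * (chi l x * fb false x) + 2^-1 * (chi l x * fb true x)) +
     1 * (2^-1 * (chi (i :: l) x * fb false x) + (- 2^-1) * (chi (i :: l) x * fb true x))).
    by apply: (Plin); apply: (Plin); apply: IH; exact: dfb.
  apply/funext => x; rewrite chi_cons.
  have -> : f x = fb (x i) x by apply: df => j _; rewrite /upd; case: eqP => [->|].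
  by case: (x i) => /=; rewrite ?expr1 ?expr0; field.
move=> s f /gen /(_ [::]).
by rewrite (_ : (fun _ => _) = f) //; apply/funext => x; rewrite chi_nil mul1r.
Qed.

Lemma finitary_chi l : finitary (chi l).
Proof. by exists l => x y xy; rewrite /chi (eq_in_count xy). Qed.

End RandomBits.
Arguments chi {R A}.

(** * The limit functional *)

Section Functional.
Variables (R : realType) (G : groupType) (t : tower G).
Local Notation D := (levels (cuts t)).
Local Notation E := (window t).
Local Notation B := (D 0%N).
Local Notation I := (nat * G)%type.
Implicit Types (f g : (I -> bool) -> R) (l : seq I).

(** The value exp (- nu (B_n)), as |S_n| translates of B_n make up a set of
    measure 1. *)
Definition sign_mean n : R := expR (- ((size (B n))%:R)^-1).

Lemma sign_mean01 n : 0 <= sign_mean n <= 1.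
Proof. by rewrite expR_ge0 /= -expR0 ler_expR oppr_le0 invr_ge0 ler0n. Qed.

(** At stage n a bit z h stands for the parity of the number of points in h B_n. *)
Definition parities n (z : G -> bool) : I -> bool := fun i =>
  odd (count z [seq (i.2 * d)%g | d <- D i.1 n]).

(** The list of places contains everything that a site (m, g) with g in window n
    looks at. *)
Definition stage n f : R := expect_bits (sign_mean n) (undup (prods (E n) (B n))) (f \o parities n).

Lemma chi_parities n l z : chi l (parities n z) = chi (expand t n l) z :> R.
Proof.
elim: l => [|i l IH]; first by rewrite /expand /= !chi_nil.
by rewrite chi_cons expand_cons chi_cat IH /parities signr_odd.
Qed.

Lemma stage_linear n f g a b : stage n (fun x => a * f x + b * g x) = a * stage n f + b * stage n g.
Proof. exact: expect_bits_linear. Qed.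

Lemma stage_ge0 n f : (forall x, 0 <= f x) -> 0 <= stage n f.
Proof. by move=> f0; apply: expect_bits_ge0 => [|z]; [exact: sign_mean01|exact: f0]. Qed.

Lemma stage_chi n l : all (fun i => i.2 \in E n) l ->
  stage n (chi l) = sign_mean n ^+ odds (expand t n l).
Proof.
move=> lE; rewrite /stage (_ : _ \o _ = chi (expand t n l)).
  rewrite expect_bits_chi ?undup_uniq // => x xl; rewrite mem_undup.
  exact: expand_window xl.
by apply/funext => z; exact: chi_parities.
Qed.

Lemma all_level l : exists N, forall n, (N <= n)%N ->
  all (fun i => i.1 <= n)%N l && all (fun i => i.2 \in E n) l.
Proof.
elim: l => [|i l [N lN]]; first by exists 0%N.
have [N' iN'] := window_near t i.2; exists (maxn i.1 (maxn N N')) => n.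
rewrite !geq_max => /and3P[in1 Nn N'n] /=; rewrite in1 iN' //=; exact: lN.
Qed.

(** The set B_n is made of n + 3 disjoint copies of B_(n+1). *)
Lemma sign_meanS n : sign_mean n.+1 ^+ n.+3 = sign_mean n.
Proof.
rewrite /sign_mean -expRM_natl mulrN size_levelS // natrM invfM mulrCA divff ?mulr1 //.
Qed.

Definition stable f := exists c N, forall n, (N <= n)%N -> stage n f = c.

(** The eventual value of the expectations. The default value 0 concerns functions
    whose expectations do not become constant. *)
Definition mean f : R := xget 0 [set c | exists N, forall n, (N <= n)%N -> stage n f = c].

Lemma stable_mean f : stable f -> exists N, forall n, (N <= n)%N -> stage n f = mean f.
Proof.
rewrite /mean => -[c [N cN]].
by case: xgetP => [y _ [N' yN']|/(_ c)]; [exists N'|case; exists N].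
Qed.

Lemma mean_eq f c N : (forall n, (N <= n)%N -> stage n f = c) -> mean f = c.
Proof.
move=> cN; have [|N' LN'] := @stable_mean f; first by exists c, N.
by rewrite -(LN' (maxn N N')) ?leq_maxr // cN // leq_maxl.
Qed.

(** By odds_expandS and sign_meanS, passing to the next stage multiplies the
    exponent by n + 3 and replaces the base by its root of that order. *)
Lemma stage_chi_stable l : exists N, forall n, (N <= n)%N ->
  stage n (chi l) = expR (- ((odds (expand t n l))%:R / (size (B n))%:R)) /\
  stage n (chi l) = stage N (chi l).
Proof.
have [N lN] := all_level l; exists N => n Nn; split.
  have /andP[_ lE] := lN n Nn; rewrite stage_chi // /sign_mean -expRM_natl mulrN.
  by [].
rewrite -(subnK Nn); elim: (n - N)%N => // k IH; rewrite -IH addSn.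
have /andP[l1 l2] := lN _ (leq_addl k N).
have /andP[_ l3] := lN _ (leq_trans (leq_addl k N) (leqnSn _)).
by rewrite !stage_chi // odds_expandS // mulnC exprM sign_meanS.
Qed.

Lemma stable_chi l : stable (chi l).
Proof.
by have [N lN] := stage_chi_stable l; exists (stage N (chi l)), N => n /lN[].
Qed.

Lemma stable_lin f g a b : stable f -> stable g -> stable (fun x => a * f x + b * g x).
Proof.
move=> [c [N cN]] [c' [N' cN']]; exists (a * c + b * c'), (maxn N N') => n.
by rewrite geq_max => /andP[/cN <- /cN' <-]; exact: stage_linear.
Qed.

Lemma stable_depends s f : depends_on s f -> stable f.
Proof. by apply: (depends_ind stable_chi) => *; exact: stable_lin. Qed.

Lemma mean_linear f g a b : stable f -> stable g ->
  mean (fun x => a * f x + b * g x) = a * mean f + b * mean g.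
Proof.
move=> /stable_mean[N fN] /stable_mean[N' gN']; apply: (@mean_eq _ _ (maxn N N')) => n.
by rewrite geq_max => /andP[/fN <- /gN' <-]; exact: stage_linear.
Qed.

Lemma mean_ge0 f : stable f -> (forall x, 0 <= f x) -> 0 <= mean f.
Proof. by move=> /stable_mean[N fN] f0; rewrite -(fN N) //; exact: stage_ge0. Qed.

Lemma mean1 : mean (fun=> 1) = 1.
Proof.
rewrite (_ : (fun=> 1) = chi [::]); last by apply/funext => x; rewrite chi_nil.
by apply: (@mean_eq _ _ 0) => n _; rewrite stage_chi.
Qed.

(** The quotient in the exponent is the measure of the symmetric difference of the
    sets of l. *)
Lemma mean_chi l : exists N, forall n, (N <= n)%N ->
  mean (chi l) = expR (- ((odds (expand t n l))%:R / (size (B n))%:R)).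
Proof.
have [N lN] := stage_chi_stable l; have [N' lN'] := stable_mean (stable_chi l).
exists (maxn N N') => n; rewrite geq_max => /andP[/lN[<- _] /lN'].
by [].
Qed.

End Functional.

(** * Translations and decorrelation *)

Lemma expR_diff (R : realType) (u v : R) : 0 <= u -> 0 <= v - u ->
  `|expR (- u) - expR (- v)| <= v - u.
Proof.
move=> u0 uv; have -> : - v = - u + (- (v - u)) by ring.
rewrite expRD; set w := v - u in uv *.
have e0 := expR_gt0 (- u).
have e1 : expR (- u) <= 1 by rewrite -expR0 ler_expR; lra.
have w1 : expR (- w) <= 1 by rewrite -expR0 ler_expR; lra.
have := expR_ge1Dx (- w) => w2.
have -> : expR (- u) - expR (- u) * expR (- w) = expR (- u) * (1 - expR (- w)) by ring.
rewrite ger0_norm ?mulr_ge0 ?subr_ge0 //; nra.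
Qed.

Section Shift.
Variables (R : realType) (G : groupType) (t : tower G).
Local Notation D := (levels (cuts t)).
Local Notation E := (window t).
Local Notation B := (D 0%N).
Local Notation I := (nat * G)%type.
Implicit Types (f : (I -> bool) -> R) (g : G) (l : seq I).
Local Notation L := (@mean R G t).

Definition translate g l : seq I := [seq (i.1, g * i.2)%g | i <- l].

(** The parity of the number of points of g P in the set h B_m is the parity of the
    number of points of P in g^-1 h B_m. *)
Definition gshift (g : G) (x : I -> bool) : I -> bool := fun i => x (i.1, g^-1 * i.2)%g.

Lemma chi_shift g l x : chi l (gshift g x) = chi (translate g^-1 l) x :> R.
Proof. by rewrite /chi count_map. Qed.

Lemma finitary_stable f : finitary f -> stable t f.
Proof. by move=> [s]; exact: stable_depends. Qed.

Lemma finitary_shift J g (f : (I -> bool) -> J) : finitary f -> finitary (fun x => f (gshift g x)).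
Proof.
move=> [s df]; exists (translate g^-1 s) => x y xy; apply: df => i si.
by apply: xy; apply/mapP; exists i.
Qed.

Lemma mean_lin f (g : (I -> bool) -> R) a b : finitary f -> finitary g ->
  L (fun x => a * f x + b * g x) = a * L f + b * L g.
Proof. by move=> /finitary_stable sf /finitary_stable sg; exact: mean_linear. Qed.

Lemma mean_translate g l : L (chi (translate g l)) = L (chi l).
Proof.
have [N lN] := mean_chi R t l; have [N' lN'] := mean_chi R t (translate g l).
rewrite (lN (maxn N N')) ?leq_maxl // (lN' (maxn N N')) ?leq_maxr //.
rewrite expand_translate odds_map_inj //; exact: mulgI.
Qed.

Lemma finitary_ind (P : ((I -> bool) -> R) -> Prop) :
  (forall l, P (chi l)) ->
  (forall a b f (g : (I -> bool) -> R), finitary f -> finitary g ->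
    P f -> P g -> P (fun x => a * f x + b * g x)) ->
  forall f, finitary f -> P f.
Proof.
move=> Pchi Plin f [s].
suff : forall s f, depends_on s f -> finitary f /\ P f by move=> h /h[].
apply: depends_ind => [l|a b f' g [df Pf] [dg Pg]]; first by split => //; exact: finitary_chi.
split; last exact: Plin.
by apply: (finitary2 (fun u v : R => a * u + b * v)).
Qed.

Lemma mean_shift g f : finitary f -> L (f \o gshift g) = L f.
Proof.
move: f; apply: finitary_ind => [l|a b f f' df df' Lf Lf'].
  rewrite (_ : _ \o _ = chi (translate g^-1 l)) ?mean_translate //.
  by apply/funext => x; exact: chi_shift.
rewrite mean_lin // -Lf -Lf' -mean_lin //; exact: finitary_shift.
Qed.

(** The measure of a symmetric difference is additive up to twice the measure of the
    intersection, and exp is 1-Lipschitz on the negative half-line. *)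
Lemma mean_chi_cat u v : exists N, forall n, (N <= n)%N ->
  `|L (chi (u ++ v)) - L (chi u) * L (chi v)| <=
   (2 * common (expand t n u) (expand t n v))%:R / (size (B n))%:R.
Proof.
have [N1 h1] := mean_chi R t u; have [N2 h2] := mean_chi R t v.
have [N3 h3] := mean_chi R t (u ++ v).
exists (maxn N1 (maxn N2 N3)) => n; rewrite !geq_max => /and3P[/h1-> /h2-> /h3->].
rewrite -expRD -opprD -mulrDl -natrD expand_cat.
have /andP[c1 c2] := odds_cat (expand t n u) (expand t n v).
have b0 : 0 < (size (B n))%:R :> R by rewrite ltr0n size_level_gt0.
apply: le_trans (expR_diff _ _) _.
- by rewrite divr_ge0.
- by rewrite -mulrBl divr_ge0 // subr_ge0 ler_nat.
- by rewrite -mulrBl ler_pM2r ?invr_gt0 // lerBlDl -natrD ler_nat.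
Qed.

(** If the sites of a h leave every finite set while their number stays bounded,
    their intersections with the sites of a fixed character have small measure by
    overlap_decay. By linearity the same holds for every finitary f. *)
Lemma escaping_decorrelates (Ginf : infinite_set [set: G]) (a : G -> seq I) (c : nat) :
  (forall h, (size (a h) <= c)%N) ->
  (forall W : seq G, \forall h \near (@frechet_filter G : set_system G),
    all (fun i => i.2 \notin W) (a h)) ->
  forall f, finitary f ->
   (L (fun x => chi (a h) x * f x) - L (chi (a h)) * L f)
     @[h --> (@frechet_filter G : set_system G)] --> (0 : R).
Proof.
have FF := frechet_properfilter Ginf.
move=> ac esc; apply: finitary_ind => [l|p q f g df dg cf cg].
  apply/cvgrPdist_le => e e0.
  have [m me] : exists m : nat, (4 * c * size l)%:R / e <= m%:R :> R.
    have x0 : 0 <= (4 * c * size l)%:R / e by rewrite divr_ge0 ?ler0n // ltW.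
    by exists (Num.bound ((4 * c * size l)%:R / e)); apply/ltW/archi_boundP.
  (* If i.2 is not in W, then j.2^-1 i.2 is outside E_m for every site j of l. *)
  pose W := [seq (j.2 * x)%g | j <- l, x <- E m].
  near=> h.
  have hW : all (fun i => i.2 \notin W) (a h) by near: h; exact: esc.
  rewrite sub0r normrN.
  rewrite (_ : (fun x => _) = chi (a h ++ l)); last first.
    by apply/funext => x; rewrite chi_cat.
  have [N hN] := mean_chi_cat (a h) l.
  have [N' hN'] : exists N, forall n, (N <= n)%N ->
      (\sum_(i <- a h) \sum_(j <- l) overlap (j.2^-1 * i.2)%g (B n) * m.+3 <=
       size (a h) * (size l * (2 * size (B n))))%N.
    elim: (a h) hW => [_|i s IH /= /andP[iW /IH[N1 hN1]]].
      by exists 0%N => n _; rewrite big_nil.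
    have [N2 hN2] : exists N, forall n, (N <= n)%N ->
      (\sum_(j <- l) overlap (j.2^-1 * i.2)%g (B n) * m.+3 <= size l * (2 * size (B n)))%N.
      have : {subset l <= l} by [].
      rewrite {1 3 4}(lock l); elim: (locked l) => [_|j r IHr rl].
        by exists 0%N => n _; rewrite big_nil.
      have [|N3 hN3] := IHr; first by move=> x xr; apply: rl; rewrite in_cons xr orbT.
      have jE : (j.2^-1 * i.2)%g \notin E m.
        apply: contra iW => jE; apply/allpairsPdep; exists j, (j.2^-1 * i.2)%g.
        by rewrite rl ?mem_head // mulVKg.
      have [N4 hN4] := overlap_decay jE.
      exists (maxn N3 N4) => n; rewrite geq_max big_cons /= mulSn => /andP[n3 n4].
      exact: leq_add (hN4 n n4) (hN3 n n3).
    exists (maxn N1 N2) => n; rewrite geq_max big_cons /= mulSn => /andP[n1 n2].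
    exact: leq_add (hN2 n n2) (hN1 n n1).
  set n := maxn N N'.
  apply: le_trans (hN n (leq_maxl _ _)) _.
  have b0 : 0 < (size (B n))%:R :> R by rewrite ltr0n size_level_gt0.
  rewrite ler_pdivrMr //.
  have m3 : 0 < m.+3%:R :> R by rewrite ltr0n.
  rewrite -(ler_pM2r m3).
  have h1 : ((2 * common (expand t n (a h)) (expand t n l)) * m.+3 <=
     (4 * c * size l) * size (B n))%N.
    have := hN' n (leq_maxr _ _).
    rewrite (eq_bigr (fun i : I => (\sum_(j <- l) overlap (j.2^-1 * i.2)%g (B n)) * m.+3)%N);
      last by move=> i _; rewrite big_distrl.
    rewrite -big_distrl /=; have := common_expand t n (a h) l; have := ac h.
    set s := (\sum_(i <- a h) _)%N => ? ? ?.
    have : (size (a h) * (size l * (2 * size (B n))) <= c * (size l * (2 * size (B n))))%N.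
      exact: leq_mul (ac h) (leqnn _).
    nia.
  rewrite -natrM; apply: (@le_trans _ _ ((4 * c * size l) * size (B n))%:R).
    by rewrite ler_nat.
  rewrite natrM mulrAC ler_pM2r // mulrC -ler_pdivrMr //.
  by apply: le_trans me _; rewrite ler_nat; lia.
have dc h k : finitary k -> finitary (fun x => chi (a h) x * k x : R).
  by move=> dk; apply: (finitary2 (fun u v : R => u * v)) => //; exact: finitary_chi.
rewrite (_ : (fun h => _) = fun h =>
   p * (L (fun x => chi (a h) x * f x) - L (chi (a h)) * L f) +
   q * (L (fun x => chi (a h) x * g x) - L (chi (a h)) * L g)); last first.
  apply/funext => h; rewrite mean_lin //.
  rewrite (_ : (fun x => _) = fun x => p * (chi (a h) x * f x) + q * (chi (a h) x * g x)).
    rewrite mean_lin; first by ring.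
    exact: dc. exact: dc.
  by apply/funext => x; ring.
rewrite -[X in _ --> X](_ : p * 0 + q * 0 = 0); last by rewrite !mulr0 addr0.
by apply: cvgD; apply: cvgMr.
Unshelve. all: by end_near. Qed.

End Shift.

(** * Probabilities on spaces of bits *)

Section Cube.
Variable A : eqType.

Definition coord_sets : set (set (A -> bool)) :=
  [set [set x : A -> bool | x i] | i in [set: A]].

Definition cube := g_sigma_algebraType coord_sets.

Lemma measurable_coord (i : A) (b : bool) : measurable ([set x | x i = b] : set cube).
Proof.
have mi : measurable ([set x | x i] : set cube) by apply: sub_gen_smallest; exists i.
case: b; first exact: mi.
rewrite (_ : mkset _ = ~` [set x : cube | x i]); first exact: measurableC.
by apply/seteqP; split => x /=; case: (x i).
Qed.

(** Induction on the number of coordinates that V depends on, cutting V according to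
    the value of one of them. *)
Lemma measurable_dep (s : seq A) (V : set cube) :
  (forall x y, {in s, x =1 y} -> V x -> V y) -> measurable V.
Proof.
elim: s V => [|i s IH] V dV.
  have [->|/set0P[x Vx]] := eqVneq V set0; first exact: measurable0.
  rewrite (_ : V = setT); first exact: measurableT.
  by apply/seteqP; split => // y _; exact: dV Vx.
pose Vb b := [set x : cube | V (upd x i b)].
rewrite (_ : V = ([set x | x i = false] `&` Vb false) `|` ([set x | x i = true] `&` Vb true)).
  have mV b : measurable (Vb b).
    apply: IH => x y xy; apply: dV => j; rewrite in_cons /upd.
    by case: eqP => //= _; exact: xy.
  by apply: measurableU; apply: measurableI; [exact: measurable_coord|exact: mV|
    exact: measurable_coord|exact: mV].
have updE x : upd x i (x i) = x by apply/funext => j; rewrite /upd; case: eqP => [->|].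
apply/seteqP; split => x /=.
  by rewrite /Vb /= => Vx; case E : (x i); [right|left]; rewrite -E updE.
by rewrite /Vb /= => -[[xi]|[xi]]; rewrite -{1}xi updE.
Qed.

Lemma finitary_measurable (v : (A -> bool) -> bool) :
  finitary v -> measurable ([set x | v x] : set cube).
Proof. by move=> [s sv]; apply: (@measurable_dep s) => x y xy /=; rewrite (sv x y). Qed.

Lemma measurable_to_cube d (T : measurableType d) (f : T -> cube) :
  (forall i, measurable [set y | f y i]) -> measurable_fun setT f.
Proof.
move=> mf; apply: (@measurability _ _ _ cube setT f coord_sets) => //.
by move=> _ [_ [i _ <-] <-]; rewrite setTI; exact: mf.
Qed.

End Cube.

Section Law.
Variables (R : realType) (A : eqType) (b : nat -> A) (b' : A -> nat).
Hypotheses (bK : cancel b b') (b'K : cancel b' b).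
Implicit Types (f : (A -> bool) -> R) (s : seq bool) (u : R).
Variable Lam : ((A -> bool) -> R) -> R.
Hypothesis Lam_lin : forall f (g : (A -> bool) -> R) p r, finitary f -> finitary g ->
  Lam (fun x => p * f x + r * g x) = p * Lam f + r * Lam g.
Hypothesis Lam_ge0 : forall f, finitary f -> (forall x, 0 <= f x) -> 0 <= Lam f.
Hypothesis Lam1 : Lam (fun=> 1) = 1.

(** Words are written with the last letter first: the head of s is the value at the
    coordinate of number (size s).-1. *)
Fixpoint cyl s (x : A -> bool) : bool :=
  if s is c :: s' then (x (b (size s')) == c) && cyl s' x else true.

Definition cylf s x : R := (cyl s x)%:R.

Lemma cyl_dep s x y : (forall k, (k < size s)%N -> x (b k) = y (b k)) -> cyl s x = cyl s y.
Proof. by elim: s => //= c s IH xy; rewrite xy // IH // => k ks; apply: xy; exact: ltnW. Qed.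

Lemma cylf_finitary s : finitary (cylf s).
Proof.
exists [seq b k | k <- iota 0 (size s)] => x y xy; rewrite /cylf (@cyl_dep s x y) // => k ks.
by apply: xy; rewrite map_f // mem_iota.
Qed.

Definition mass s : R := Lam (cylf s).

Lemma mass_ge0 s : 0 <= mass s.
Proof. by apply: Lam_ge0 => [|x]; [exact: cylf_finitary|rewrite /cylf ler0n]. Qed.

Lemma mass_nil : mass [::] = 1.
Proof. exact: Lam1. Qed.

Lemma mass_split s : mass s = mass (false :: s) + mass (true :: s).
Proof.
rewrite -[X in X + _]mul1r -[X in _ + X]mul1r -Lam_lin; try exact: cylf_finitary.
congr Lam; apply/funext => x; rewrite /cylf /=.
by case: (x _); case: (cyl s x); rewrite /= !mul1r ?addr0 ?add0r.
Qed.

(** [0, 1) is cut into intervals of lengths mass s, where s runs through the words of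
    a given size in lexicographic order; left s is the left end of the interval of
    s. *)
Fixpoint left s : R :=
  if s is c :: s' then left s' + (if c then mass (false :: s') else 0) else 0.

(** The word of size k whose interval contains u. *)
Fixpoint word u k : seq bool :=
  if k is k'.+1 then let s := word u k' in (left s + mass (false :: s) <= u) :: s else [::].

(** The family of bits all of whose prefixes are the words of u. *)
Definition expansion u : cube A := fun i =>
  let s := word u (b' i) in left s + mass (false :: s) <= u.

Lemma size_word u k : size (word u k) = k.
Proof. by elim: k => //= k ->. Qed.

Lemma expansion_cyl s u : cyl s (expansion u) = (word u (size s) == s).
Proof.
elim: s => [|c s IH] //=; rewrite eqseq_cons IH /expansion bK.
by case: (word u (size s) =P s) => [->//|]; rewrite !andbF.
Qed.

Lemma word_itv s u : 0 <= u < 1 -> (word u (size s) == s) = (left s <= u < left s + mass s).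
Proof.
move=> u01; elim: s => [|c s IH]; first by rewrite /= mass_nil add0r.
rewrite [word _ _]/= eqseq_cons [left _]/=.
have := mass_split s; have := mass_ge0 (false :: s); have := mass_ge0 (true :: s).
move=> q1 q0 qs; case: (word u (size s) =P s) IH => [-> |_] /esym.
  rewrite andbT => /andP[l1 l2]; case: c; apply/eqP/andP; rewrite /= ?addr0.
  - by move=> h; split => //; lra.
  - by case.
  - by move=> h; split => //; rewrite ltNge h.
  - by case=> _; rewrite ltNge => /negbTE.
rewrite andbF => h; apply/esym/negbTE; apply: contraFN h => /andP[].
by case: c; rewrite /= ?addr0 => h1 h2; apply/andP; split; lra.
Qed.

Lemma left_bounds s : 0 <= left s /\ left s + mass s <= 1.
Proof.
elim: s => [|c s [IH1 IH2]]; first by rewrite /= mass_nil add0r.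
have := mass_split s; have := mass_ge0 (false :: s); have := mass_ge0 (true :: s).
by case: c; rewrite /= ?addr0; split; lra.
Qed.

Lemma measurable_word s : measurable [set u | word u (size s) = s].
Proof.
elim: s => [|c s IH] /=; first by rewrite (_ : mkset _ = setT) //; apply/seteqP.
rewrite (_ : mkset _ = [set u | word u (size s) = s] `&`
    (if c then `[left s + mass (false :: s), +oo[%classic
     else `]-oo, left s + mass (false :: s)[%classic)).
  by apply: measurableI => //; case: c.
apply/seteqP; split => u /=.
  by move=> [+ e]; rewrite e; case: c; rewrite /= in_itv /= ?andbT // => /negbT; rewrite -ltNge.
move=> [->]; case: c => /=; rewrite in_itv /= ?andbT; first by move=> ->.
by rewrite ltNge => /negbTE ->.
Qed.

Lemma measurable_expansion : measurable_fun [set: measurableTypeR R] expansion.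
Proof.
apply: measurable_to_cube => i; rewrite /expansion.
rewrite (_ : mkset _ = \bigcup_s ([set u | word u (size s) = s] `&`
   [set u | size s = b' i /\ left s + mass (false :: s) <= u])).
  apply: countable_bigcupT_measurable; first exact: countableP.
  move=> s; apply: measurableI; first exact: measurable_word.
  have [e|ne] := eqVneq (size s) (b' i).
    rewrite (_ : mkset _ = `[left s + mass (false :: s), +oo[%classic) //.
    by apply/seteqP; split => u /=; rewrite in_itv /= andbT => // -[].
  rewrite (_ : mkset _ = set0) //; apply/seteqP; split => u //= -[e].
  by rewrite e eqxx in ne.
apply/seteqP; split => u /=.
  by move=> h; exists (word u (b' i)) => //=; rewrite size_word.
by move=> [s _ /= [<- [<-]]]; rewrite size_word.
Qed.

Let RR : measurableType _ := measurableTypeR R.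

Definition expansion_mfun : {mfun RR >-> cube A} :=
  @mfun_Sub _ _ RR (cube A) expansion (mem_set measurable_expansion).

Let U : probability RR R := uniform_prob (@ltr01 R).

Definition law : probability (cube A) R := distribution U expansion_mfun.

Lemma uniform_itv (x y : R) : 0 <= x -> y <= 1 -> x <= y ->
  U `[x, y[%classic = (y - x)%:E.
Proof.
move=> x0 y1 xy; rewrite /U /= /uniform_prob integral_uniform_pdf.
rewrite setIidl; last first.
  move=> u /=; rewrite !in_itv /= => /andP[xu uy].
  by rewrite (le_trans x0 xu) (le_trans (ltW uy) y1).
rewrite (eq_integral (fun=> 1%:E)); last first.
  move=> u; rewrite inE /= in_itv /= => /andP[xu uy].
  by rewrite /uniform_pdf (le_trans x0 xu) (le_trans (ltW uy) y1) subr0 invr1.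
rewrite integral_cst //= mul1e lebesgue_measure_itv /= lte_fin.
by case: ltP => // yx; rewrite (le_anti (introT andP (conj xy yx))) subrr.
Qed.

Lemma law_cyl s : law [set x | cyl s x] = (mass s)%:E.
Proof.
have [l0 l1] := left_bounds s; have q0 := mass_ge0 s.
have mcyl : measurable [set u : measurableTypeR R | cyl s (expansion u)].
  rewrite (_ : mkset _ = [set u | word u (size s) = s]); first exact: measurable_word.
  by apply/seteqP; split => u /=; rewrite expansion_cyl => /eqP.
rewrite /law /distribution /pushforward /=.
rewrite -[LHS]/(U [set u | cyl s (expansion u)]).
set V := [set u | cyl s (expansion u)].
pose J0 : set R := `[0, 1[%classic.
(* The point 1 is the only one of [0, 1] not covered by word_itv. *)
have nul : U (V `\` J0) = 0%E.
  apply/eqP; rewrite -measure_le0 -[X in (_ <= X)%E](subee (x := 1%E)) //.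
  have <- : U (~` J0) = (1 - 1)%E.
    rewrite probability_setC; first by congr (1 - _)%E; rewrite /J0 uniform_itv // subr0.
    exact: (measurable_itv `[0 : R, 1[).
  rewrite le_measure ?inE //.
    exact: measurableD mcyl (measurable_itv _).
  exact: measurableC (measurable_itv _).
rewrite -[RHS](_ : U `[left s, left s + mass s[%classic = _); last first.
  by rewrite uniform_itv ?lerDl // addrC addKr.
have -> : U V = (U (V `\` J0) + U (V `&` J0))%E.
  exact: measureDI mcyl (measurable_itv _).
rewrite nul add0e.
congr (U _); apply/seteqP; split => u; rewrite /V /J0 /= !in_itv /= expansion_cyl.
  by move=> [h u01]; rewrite -word_itv.
move=> h; have u01 : 0 <= u < 1 by move/andP: h => [h1 h2]; apply/andP; split; lra.
by rewrite word_itv.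
Qed.

Lemma finitary_cyl s : finitary (cyl s).
Proof.
exists [seq b k | k <- iota 0 (size s)] => x y xy; apply: cyl_dep => k ks.
by apply: xy; rewrite map_f // mem_iota.
Qed.

(** Downward induction on the length of s: on a cylinder that fixes all coordinates
    v depends on, v is constant, and a shorter cylinder is the union of two longer
    ones. *)
Lemma law_finitary_cyl (v : (A -> bool) -> bool) m s : finitary v ->
  (forall x y, (forall k, (k < size s + m)%N -> x (b k) = y (b k)) -> v x = v y) ->
  law [set x | v x && cyl s x] = (Lam (fun x => (v x && cyl s x)%:R))%:E.
Proof.
move=> bv; elim: m s => [|m IH] s vs.
  have [[x0 /andP[vx0 sx0]]|nV] := pselect (exists x, v x && cyl s x).
    have vE x : cyl s x -> v x.
      move=> sx; rewrite -(vs x0) // addn0 {vs}.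
      elim: s sx0 sx => // c s IH /= /andP[/eqP e /IH{}IH] /andP[/eqP e' /IH{}IH] k.
      by rewrite ltnS leq_eqVlt => /predU1P[->|/IH//]; rewrite e e'.
    have vcE x : v x && cyl s x = cyl s x by case E: (cyl s x); rewrite ?andbF ?vE.
    rewrite (_ : [set x | _] = [set x | cyl s x]); last first.
      by apply/seteqP; split => x /=; rewrite vcE.
    by rewrite law_cyl; congr (Lam _)%:E; apply/funext => x; rewrite vcE.
  have vcE x : v x && cyl s x = false by apply/negP => h; apply: nV; exists x.
  rewrite (_ : [set x | _] = set0); last by apply/seteqP; split => x //=; rewrite vcE.
  rewrite measure0 (_ : (fun x => _) = (fun x => 0 * 1 + 0 * 1)).
    by rewrite Lam_lin ?mul0r ?addr0 //; exact: finitary_cst.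
  by apply/funext => x; rewrite vcE mul0r addr0.
have bsplit c : finitary (fun x => v x && cyl (c :: s) x).
  by apply: finitary2 => //; exact: finitary_cyl.
have -> : (fun x => (v x && cyl s x)%:R : R) = fun x => 1 * (v x && cyl (false :: s) x)%:R +
   1 * (v x && cyl (true :: s) x)%:R.
  apply/funext => x /=; case: (x _); case: (v x); case: (cyl s x);
    by rewrite /= !mul1r ?addr0 ?add0r.
rewrite Lam_lin ?mul1r ?EFinD; try exact: (finitary_natr R (bsplit _)).
rewrite -!IH; try by move=> x y xy; apply: vs => k kn; apply: xy; rewrite /= addSnnS.
rewrite (_ : [set x | v x && cyl s x] = [set x | v x && cyl (false :: s) x] `|`
   [set x | v x && cyl (true :: s) x]).
  rewrite measureU //; try exact: finitary_measurable (bsplit _).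
  by apply/seteqP; split => x //= [/and3P[_ /eqP-> _] /and3P[_ /eqP]].
apply/seteqP; split => x /=.
  by case: (x _) => h; [right|left]; rewrite h.
by case: (x _); case: (v x); case: (cyl s x) => // -[].
Qed.

Lemma law_finitary (v : (A -> bool) -> bool) :
  finitary v -> law [set x | v x] = (Lam (fun x => (v x)%:R))%:E.
Proof.
move=> bv; have [s sv] := bv.
have := @law_finitary_cyl v (\sum_(i <- s) (b' i).+1)%N [::] bv.
rewrite (_ : [set x | v x && cyl [::] x] = [set x | v x]); last first.
  by apply/seteqP; split => x /=; rewrite andbT.
rewrite (_ : (fun x => (v x && _)%:R) = (fun x => (v x)%:R)); last first.
  by apply/funext => x; rewrite andbT.
apply=> x y xy; apply: sv => i si; rewrite -[i]b'K; apply: xy.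
by rewrite /= (big_rem i) //= add0n addSn ltnS leq_addr.
Qed.

End Law.

(** * Entropy of finite-valued variables *)

Section Gibbs.
Variable R : realType.
Implicit Types x y p q : R.

(** This is ln (q / p) <= q / p - 1. *)
Lemma plnp_gibbs p q : 0 <= p -> 0 <= q -> (q = 0 -> p = 0) ->
  p * ln q - p * ln p <= q - p.
Proof.
move=> p0 q0 qp; have [->|pn0] := eqVneq p 0; first by rewrite !mul0r !subr0.
have qn0 : q != 0 by apply: contra pn0 => /eqP/qp ->.
have pp : 0 < p by rewrite lt_def pn0.
have qq : 0 < q by rewrite lt_def qn0.
rewrite -mulrBr -ln_div ?posrE //.
have h : ln (q / p) <= q / p - 1.
  rewrite -[X in ln X](subrK 1) addrC; apply: le_ln1Dx.
  by rewrite ltrBrDl subrr divr_gt0.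
apply: le_trans (ler_wpM2l p0 h) _.
by rewrite mulrBr mulr1 mulrCA divff // mulr1.
Qed.

Lemma gibbs (J : finType) (p q : J -> R) :
  (forall j, 0 <= p j) -> (forall j, 0 <= q j) -> (forall j, q j = 0 -> p j = 0) ->
  \sum_j q j <= \sum_j p j ->
  - \sum_j p j * ln (p j) <= - \sum_j p j * ln (q j).
Proof.
move=> p0 q0 qp le1; rewrite lerN2 -subr_le0 -sumrB.
apply: (@le_trans _ _ (\sum_j (q j - p j))).
  by apply: ler_sum => j _; apply: plnp_gibbs => //; exact: qp.
by rewrite sumrB subr_le0.
Qed.

Lemma plnp_le p q : 0 <= p <= q -> p * ln p <= p * ln q.
Proof.
move=> /andP[]; rewrite le_eqVlt => /predU1P[<- _|p0 pq]; first by rewrite !mul0r.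
by rewrite ler_pM2l // ler_ln // posrE // (lt_le_trans p0).
Qed.

(** Put s = sqrt p; then - p ln p = 2 s (- s ln s), and - s ln s <= 1 - s. *)
Lemma plnp_small p : 0 <= p <= 1 -> - (p * ln p) <= 2 * Num.sqrt p.
Proof.
move=> /andP[p0 p1]; set s := Num.sqrt p.
have s0 : 0 <= s by exact: sqrtr_ge0.
have ps : p = s ^+ 2 by rewrite sqr_sqrtr.
have [s_eq0|sn0] := eqVneq s 0; first by rewrite ps s_eq0 expr0n /= mul0r oppr0 mulr0.
have sp : 0 < s by rewrite lt_def sn0.
have s1 : s <= 1.
  have : s ^+ 2 <= 1 by rewrite -ps.
  by move=> h; nra.
have h : s * ln 1 - s * ln s <= 1 - s.
  by apply: plnp_gibbs => // h; have := oner_neq0 R; rewrite h eqxx.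
rewrite ln1 mulr0 sub0r in h.
rewrite ps lnXn //.
have -> : - (s ^+ 2 * (ln s *+ 2)) = 2 * s * (- (s * ln s)) by ring.
nra.
Qed.

Lemma plnp_near1 p : 0 <= p <= 1 -> - (p * ln p) <= 1 - p.
Proof.
move=> /andP[p0 p1]; have := @plnp_gibbs p 1 p0 ler01.
by rewrite ln1 mulr0 sub0r; apply => /eqP; rewrite oner_eq0.
Qed.

Lemma sqrt_modulus (c e : R) : 0 <= c -> 0 < e ->
  exists2 dl : R, 0 < dl & c * Num.sqrt dl + dl <= e.
Proof.
move=> c0 e0; pose n := Num.min 1 (e / (c + 1)).
have n0 : 0 < n by rewrite /n lt_min ltr01 divr_gt0 //; lra.
exists (n ^+ 2); first by rewrite exprn_gt0.
rewrite sqrtr_sqr ger0_norm; last exact: ltW.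
have n1 : n <= 1 by rewrite /n ge_min lexx.
have : n <= e / (c + 1) by rewrite /n ge_min lexx orbT.
rewrite ler_pdivlMr; last by lra.
have : n ^+ 2 <= n by rewrite expr2 -[leRHS]mulr1 ler_pM2l.
move=> h1 /(le_trans _) -> //; rewrite mulrDr mulr1 [n * c]mulrC.
by rewrite lerD2l.
Qed.

End Gibbs.

Section Entropy.
Context {R : realType} {d} {X : measurableType d} (mu : probability X R).
Implicit Types (J K : finType) (V W : set X).

Definition prob V : R := fine (mu V).

Lemma probE V : measurable V -> mu V = (prob V)%:E.
Proof. by move=> mV; rewrite fineK // fin_num_measure. Qed.

Lemma prob_ge0 V : 0 <= prob V. Proof. by rewrite fine_ge0. Qed.

Lemma prob_setT : prob setT = 1. Proof. by rewrite /prob probability_setT. Qed.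

Lemma prob_set0 : prob set0 = 0. Proof. by rewrite /prob measure0. Qed.

Lemma probU V W : measurable V -> measurable W -> V `&` W = set0 ->
  prob (V `|` W) = prob V + prob W.
Proof. by move=> mV mW VW; rewrite /prob measureU // fineD // fin_num_measure. Qed.

Lemma prob_le V W : measurable V -> measurable W -> V `<=` W -> prob V <= prob W.
Proof.
by move=> mV mW VW; rewrite fine_le ?fin_num_measure // le_measure // inE.
Qed.

Lemma prob_leU V W : measurable V -> measurable W -> prob (V `|` W) <= prob V + prob W.
Proof.
move=> mV mW; rewrite -lee_fin EFinD -!probE //; last exact: measurableU.
exact: measureU2.
Qed.

Lemma prob_big_le (I : Type) (r : seq I) (V : I -> set X) : (forall j, measurable (V j)) ->
  prob (\big[setU/set0]_(j <- r) V j) <= \sum_(j <- r) prob (V j).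
Proof.
move=> mV; elim: r => [|j r IH]; first by rewrite !big_nil prob_set0.
rewrite !big_cons; apply: le_trans (prob_leU _ _) _ => //; first exact: bigsetU_measurable.
by rewrite lerD2l.
Qed.

Definition fin_rv J (f : X -> J) := forall j, measurable [set x | f x = j].

Definition law_of J (f : X -> J) j : R := prob [set x | f x = j].

Definition entropy J (f : X -> J) : R := - \sum_j law_of f j * ln (law_of f j).

Lemma fin_rv_seq J (f : X -> J) (s : seq J) : fin_rv f -> uniq s ->
  measurable [set x | f x \in s] /\ prob [set x | f x \in s] = \sum_(j <- s) law_of f j.
Proof.
move=> mf; elim: s => [_|j s IH /= /andP[js us]].
  rewrite big_nil (_ : mkset _ = set0) ?prob_set0; first by split => //; exact: measurable0.
  by apply/seteqP; split.
have [m1 e1] := IH us.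
rewrite (_ : mkset _ = [set x | f x = j] `|` [set x | f x \in s]).
  split; first exact: measurableU.
  rewrite probU // ?big_cons ?e1 //.
  by apply/seteqP; split => x //= [->]; apply/negP.
apply/seteqP; split => x /=; rewrite in_cons.
  by move=> /predU1P[]; [left|right].
by move=> [->|->]; rewrite ?eqxx ?orbT.
Qed.

Lemma fin_rv_pred J (f : X -> J) (P : pred J) : fin_rv f -> measurable [set x | P (f x)].
Proof.
move=> mf; rewrite (_ : mkset _ = \bigcup_(j in [set j | P j]) [set x | f x = j]).
  by apply: fin_bigcup_measurable => [|j _]; [exact: finite_finset|exact: mf].
by apply/seteqP; split => x /=; [move=> Px; exists (f x)|case=> j Pj /= ->].
Qed.

Lemma prob_pred J (f : X -> J) (P : pred J) : fin_rv f ->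
  prob [set x | P (f x)] = \sum_(j | P j) law_of f j.
Proof.
move=> mf; have [_] := fin_rv_seq mf (enum_uniq P).
rewrite (_ : mkset _ = [set x | P (f x)]); first by move->; rewrite big_enum.
by apply/seteqP; split => x /=; rewrite mem_enum.
Qed.

Lemma sum_law J (f : X -> J) : fin_rv f -> \sum_j law_of f j = 1.
Proof.
move=> mf; rewrite -(prob_pred xpredT mf) -prob_setT; congr prob.
by apply/seteqP; split.
Qed.

Lemma law_ge0 J (f : X -> J) j : 0 <= law_of f j. Proof. exact: prob_ge0. Qed.

Lemma fin_rv_comp J K (h : J -> K) (f : X -> J) : fin_rv f -> fin_rv (h \o f).
Proof.
move=> mf k; rewrite (_ : mkset _ = [set x | (fun j => h j == k) (f x)]).
  exact: (fin_rv_pred (fun j => h j == k) mf).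
by apply/seteqP; split => x /= /eqP.
Qed.

Lemma law_comp J K (h : J -> K) (f : X -> J) k : fin_rv f ->
  law_of (h \o f) k = \sum_(j | h j == k) law_of f j.
Proof.
move=> mf; rewrite -prob_pred //; congr prob.
by apply/seteqP; split => x /= /eqP.
Qed.

Lemma law_le1 J (f : X -> J) j : fin_rv f -> law_of f j <= 1.
Proof.
move=> mf; rewrite -(sum_law mf) (bigD1 j) //= lerDl sumr_ge0 // => i _; exact: law_ge0.
Qed.

(** The probability of a value of f is at most that of its image under h. *)
Lemma entropy_comp J K (h : J -> K) (f : X -> J) : fin_rv f ->
  entropy (h \o f) <= entropy f.
Proof.
move=> mf; rewrite /entropy lerN2 (partition_big h xpredT) //=.
apply: ler_sum => k _; rewrite law_comp // mulr_suml; apply: ler_sum => j jk.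
rewrite plnp_le // law_ge0 /= (bigD1 j) //= lerDl sumr_ge0 // => i _; exact: law_ge0.
Qed.

Lemma fin_rv_pair J K (f : X -> J) (g : X -> K) : fin_rv f -> fin_rv g ->
  fin_rv (fun x => (f x, g x)).
Proof.
move=> mf mg [j k]; rewrite (_ : mkset _ = [set x | f x = j] `&` [set x | g x = k]).
  exact: measurableI.
by apply/seteqP; split => x /= [-> ->].
Qed.

Lemma law_fst_ge J K (h : J -> K) (f : X -> J) j : fin_rv f ->
  law_of f j <= law_of (h \o f) (h j).
Proof.
move=> mf; rewrite law_comp // (bigD1 j) //= lerDl sumr_ge0 // => i _; exact: law_ge0.
Qed.

(** Gibbs' inequality for the joint law and the product of the marginals. *)
Lemma entropy_pair J K (f : X -> J) (g : X -> K) : fin_rv f -> fin_rv g ->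
  entropy (fun x => (f x, g x)) <= entropy f + entropy g.
Proof.
move=> mf mg; set fg := fun x => (f x, g x).
have mfg : fin_rv fg by exact: fin_rv_pair.
pose q (i : J * K) := law_of f i.1 * law_of g i.2.
have le1 i : law_of fg i <= law_of f i.1 by exact: (@law_fst_ge _ _ fst fg i mfg).
have le2 i : law_of fg i <= law_of g i.2 by exact: (@law_fst_ge _ _ snd fg i mfg).
have null (a b : R) : 0 <= a <= b -> b = 0 -> a = 0.
  by move=> /andP[a0 ab] b0; apply/eqP; rewrite eq_le a0 -b0 ab.
have q0 i : q i = 0 -> law_of fg i = 0.
  move/eqP; rewrite mulf_eq0 => /orP[] /eqP; apply: null; rewrite law_ge0 /=.
    exact: le1.
  exact: le2.
apply: le_trans (@gibbs _ _ (law_of fg) q _ _ q0 _) _.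
- by move=> i; exact: law_ge0.
- by move=> i; rewrite mulr_ge0 // law_ge0.
- rewrite (sum_law mfg) -(pair_bigA _ (fun j k => q (j, k))) /=.
  under eq_bigr do rewrite /q /= -mulr_sumr sum_law // mulr1.
  by rewrite sum_law.
rewrite -opprD lerN2 le_eqVlt; apply/orP; left; apply/eqP.
have -> : \sum_i law_of fg i * ln (q i) =
    \sum_i law_of fg i * ln (law_of f i.1) + \sum_i law_of fg i * ln (law_of g i.2).
  rewrite -big_split /=; apply: eq_bigr => i _.
  have [qi0|qn0] := eqVneq (q i) 0; first by rewrite (q0 _ qi0) !mul0r addr0.
  have := qn0; rewrite /q mulf_eq0 negb_or => /andP[n1 n2].
  by rewrite lnM ?mulrDr // posrE lt_def ?n1 ?n2 law_ge0.
congr (_ + _).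
  rewrite [RHS](partition_big fst xpredT) //=; apply: eq_bigr => j _.
  rewrite {1}(_ : law_of f j = \sum_(i | i.1 == j) law_of fg i) ?mulr_suml; last first.
    exact: (law_comp fst j mfg).
  by apply: eq_bigr => i /eqP ->.
rewrite [RHS](partition_big snd xpredT) //=; apply: eq_bigr => k _.
rewrite {1}(_ : law_of g k = \sum_(i | i.2 == k) law_of fg i) ?mulr_suml; last first.
    exact: (law_comp snd k mfg).
by apply: eq_bigr => i /eqP ->.
Qed.

Lemma entropy_ge0 J (f : X -> J) : fin_rv f -> 0 <= entropy f.
Proof.
move=> mf; rewrite /entropy oppr_ge0 sumr_le0 // => j _.
by rewrite mulr_ge0_le0 ?law_ge0 // ln_le0 // law_le1.
Qed.

Lemma fin_rv_ffun J (I : finType) (f : I -> X -> J) : (forall i, fin_rv (f i)) ->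
  fin_rv (fun x => [ffun i => f i x]).
Proof.
move=> mf a; rewrite (_ : mkset _ = \bigcap_(i in [set: I]) [set x | f i x = a i]).
  by apply: fin_bigcap_measurable => [|i _]; [exact: finite_finset|exact: mf].
apply/seteqP; split => x /=.
  by move=> <- i _; rewrite /= ffunE.
by move=> h; apply/ffunP => i; rewrite ffunE; exact: h.
Qed.

(** The same argument as for pairs, with the product of all the marginals. *)
Lemma entropy_ffun J (I : finType) (f : I -> X -> J) : (forall i, fin_rv (f i)) ->
  entropy (fun x => [ffun i => f i x]) <= \sum_i entropy (f i).
Proof.
move=> mf; set F := fun x => _; have mF : fin_rv F by exact: fin_rv_ffun.
pose q (a : {ffun I -> J}) := \prod_i law_of (f i) (a i).
have leF i a : law_of F a <= law_of (f i) (a i).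
  rewrite (_ : f i = (fun b : {ffun I -> J} => b i) \o F).
    exact: (law_fst_ge (fun b : {ffun I -> J} => b i)).
  by apply/funext => x; rewrite /F /= ffunE.
have q0 a : q a = 0 -> law_of F a = 0.
  move/eqP => /prodf_eq0[i _ /eqP e].
  by apply/eqP; rewrite eq_le law_ge0 -e leF.
apply: le_trans (@gibbs _ _ (law_of F) q _ _ q0 _) _.
- by move=> i; exact: law_ge0.
- by move=> a; apply: prodr_ge0 => i _; exact: law_ge0.
- rewrite (sum_law mF) -(bigA_distr_bigA (fun i j => law_of (f i) j)) /=.
  by rewrite big1 // => i _; exact: sum_law.
have lnq a : law_of F a * ln (q a) = \sum_i law_of F a * ln (law_of (f i) (a i)).
  have [qa0|qn0] := eqVneq (q a) 0.
    by rewrite (q0 _ qa0) mul0r big1 // => i _; rewrite mul0r.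
  have pos i : 0 < law_of (f i) (a i).
    by rewrite lt_def law_ge0 andbT; move/prodf_neq0: qn0; exact.
  rewrite -mulr_sumr; congr (_ * _).
  have [] : 0 < q a /\ ln (q a) = \sum_i ln (law_of (f i) (a i)) => //.
  rewrite /q; apply: (big_ind2 (fun u v : R => 0 < u /\ ln u = v)).
  - by rewrite ln1.
  - by move=> u v u' v' [u0 <-] [u'0 <-]; rewrite mulr_gt0 // lnM.
  - by move=> i _; split.
rewrite (eq_bigr _ (fun a _ => lnq a)) exchange_big /= -sumrN.
apply: ler_sum => i _; rewrite lerN2 le_eqVlt; apply/orP; left; apply/eqP.
have fiE : f i = (fun b : {ffun I -> J} => b i) \o F.
  by apply/funext => x; rewrite /F /= ffunE.
rewrite [RHS](partition_big (fun b : {ffun I -> J} => b i) xpredT) //=.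
apply: eq_bigr => j _.
rewrite {1}(_ : law_of (f i) j = \sum_(b : {ffun I -> J} | b i == j) law_of F b) ?mulr_suml.
  by apply: eq_bigr => a /eqP <-.
rewrite fiE; exact: (law_comp (fun b : {ffun I -> J} => b i) j mF).
Qed.

(** Each unlikely value contributes at most 2 sqrt delta, the likely one at most
    delta. *)
Lemma entropy_concentrated J (f : X -> J) j0 (delta : R) : fin_rv f ->
  prob [set x | f x != j0] <= delta ->
  entropy f <= 2 * #|J|%:R * Num.sqrt delta + delta.
Proof.
move=> mf; rewrite (prob_pred (fun j => j != j0)) // => le_d.
have d0 : 0 <= delta by apply: le_trans le_d; apply: sumr_ge0 => j _; exact: law_ge0.
have := sum_law mf; rewrite (bigD1 j0) //= => sum1.
rewrite /entropy -sumrN (bigD1 j0) //= addrC lerD //; last first.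
  apply: le_trans (plnp_near1 _) _; first by rewrite law_ge0 law_le1.
  by lra.
apply: (@le_trans _ _ (\sum_(j : J) 2 * Num.sqrt delta)).
  rewrite [leRHS](bigID (fun j => j != j0)) /= -[leLHS]addr0 lerD //; last first.
    by apply: sumr_ge0 => j _; rewrite mulr_ge0 // sqrtr_ge0.
  apply: ler_sum => j jj0; apply: le_trans (plnp_small _) _.
    by rewrite law_ge0 law_le1.
  rewrite ler_wpM2l // ler_sqrt //; apply: le_trans le_d.
  by rewrite (bigD1 j) //= lerDl sumr_ge0 // => i _; exact: law_ge0.
by rewrite sumr_const -[leLHS]mulr_natl cardE /= mulrCA mulrA.
Qed.

(** The measure of the symmetric difference, a pseudometric on events. *)
Definition sdist V W : R := prob (V `\` W) + prob (W `\` V).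

Lemma probD_le V W Z : measurable V -> measurable W -> measurable Z ->
  prob (V `\` Z) <= prob (V `\` W) + prob (W `\` Z).
Proof.
move=> mV mW mZ; apply: le_trans (prob_leU _ _); try exact: measurableD.
apply: prob_le; [exact: measurableD|by apply: measurableU; exact: measurableD|].
by move=> x [Vx nZ]; have [Wx|nW] := pselect (W x); [right|left].
Qed.

Lemma sdist_triangle V W Z : measurable V -> measurable W -> measurable Z ->
  sdist V Z <= sdist V W + sdist W Z.
Proof.
move=> mV mW mZ; have := probD_le mV mW mZ; have := probD_le mZ mW mV.
by rewrite /sdist; lra.
Qed.

Lemma prob_sub_le V W : measurable V -> measurable W -> prob V <= prob W + prob (V `\` W).
Proof.
move=> mV mW; apply: le_trans (prob_leU _ _); try by []; last exact: measurableD.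
apply: prob_le => //; first by apply: measurableU => //; exact: measurableD.
by move=> x Vx; have [Wx|nW] := pselect (W x); [left|right].
Qed.

Lemma prob_sdist V W : measurable V -> measurable W -> `|prob V - prob W| <= sdist V W.
Proof.
move=> mV mW; have := prob_sub_le mV mW; have := prob_sub_le mW mV.
have := prob_ge0 (V `\` W); have := prob_ge0 (W `\` V).
by rewrite /sdist ler_norml; move=> *; apply/andP; split; lra.
Qed.

Lemma probDI_le V W V' W' : measurable V -> measurable W -> measurable V' -> measurable W' ->
  prob ((V `&` W) `\` (V' `&` W')) <= prob (V `\` V') + prob (W `\` W').
Proof.
move=> mV mW mV' mW'; apply: le_trans (prob_leU _ _); try exact: measurableD.
apply: prob_le; first by apply: measurableD; exact: measurableI.
  by apply: measurableU; exact: measurableD.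
move=> x [[Vx Wx] h]; have [V'x|nV'] := pselect (V' x); last by left.
by right; split => // W'x; apply: h.
Qed.

Lemma sdistI V W V' W' : measurable V -> measurable W -> measurable V' -> measurable W' ->
  sdist (V `&` W) (V' `&` W') <= sdist V V' + sdist W W'.
Proof.
move=> mV mW mV' mW'; have := probDI_le mV mW mV' mW'; have := probDI_le mV' mW' mV mW.
by rewrite /sdist; lra.
Qed.

Lemma probDU_le V W V' W' : measurable V -> measurable W -> measurable V' -> measurable W' ->
  prob ((V `|` W) `\` (V' `|` W')) <= prob (V `\` V') + prob (W `\` W').
Proof.
move=> mV mW mV' mW'; apply: le_trans (prob_leU _ _); try exact: measurableD.
apply: prob_le; first by apply: measurableD; exact: measurableU.
  by apply: measurableU; exact: measurableD.
by move=> x [[Vx|Wx] h]; [left|right]; split => // h'; apply: h; [left|right].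
Qed.

Lemma sdistU V W V' W' : measurable V -> measurable W -> measurable V' -> measurable W' ->
  sdist (V `|` W) (V' `|` W') <= sdist V V' + sdist W W'.
Proof.
move=> mV mW mV' mW'; have := probDU_le mV mW mV' mW'; have := probDU_le mV' mW' mV mW.
by rewrite /sdist; lra.
Qed.

Lemma sdistC_set V W : sdist (~` V) (~` W) = sdist V W.
Proof. by rewrite /sdist !setDE !setCK addrC; congr (prob _ + prob _); rewrite setIC. Qed.

Lemma prob_bigcup_tail (V : nat -> set X) (e : R) : (forall n, measurable (V n)) -> 0 < e ->
  exists N, prob ((\bigcup_n V n) `\` (\big[setU/set0]_(n < N) V n)) <= e.
Proof.
move=> mV e0; pose B N := \big[setU/set0]_(n < N) V n.
have mB N : measurable (B N) by exact: bigsetU_measurable.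
have BE : \bigcup_n B n = \bigcup_n V n.
  apply/seteqP; split => x [n _]; rewrite /B.
    by rewrite -bigcup_mkord => -[m _ Vm]; exists m.
  by move=> Vn; exists n.+1 => //; rewrite -bigcup_mkord; exists n => /=.
have : mu \o B @ \oo --> mu (\bigcup_n B n).
  apply: nondecreasing_cvg_mu => //; first by rewrite BE; exact: bigcup_measurable.
  by move=> m n mn; apply/subsetPset; exact: subset_bigsetU.
have mU : measurable (\bigcup_n V n) by exact: bigcup_measurable.
rewrite BE (probE mU) => /fine_cvgP[_ /cvgrPdist_le /(_ e e0)] [N _ /(_ N (leqnn N))] /= h.
exists N; apply: le_trans h; apply: le_trans (ler_norm _).
have sub : B N `<=` \bigcup_n V n by rewrite -BE; exact: bigcup_sup.
have -> : prob (\bigcup_n V n) = prob ((\bigcup_n V n) `\` B N) + prob (B N).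
  rewrite -[in RHS]probU; [|exact: measurableD|exact: mB|by rewrite setIC setDIK].
  by congr prob; rewrite setUC setDUK.
by rewrite addrK.
Qed.

End Entropy.

(** * Approximation by finitary events *)

Section Approximation.
Variables (R : realType) (A : eqType) (mu : probability (cube A) R).
Local Notation pr := (prob mu).
Local Notation pdist := (sdist mu).

Definition approx (V : set (cube A)) := measurable V /\
  forall e : R, 0 < e -> exists2 v : (_ -> bool) -> bool, finitary v & pdist V [set x | v x] <= e.

Lemma sdistvv (V : set (cube A)) : pdist V V = 0.
Proof. by rewrite /sdist setDv prob_set0 addr0. Qed.

Lemma approxU V W : approx V -> approx W -> approx (V `|` W).
Proof.
move=> [mV aV] [mW aW]; split; first exact: measurableU.
move=> e e0; have e2 : 0 < e / 2 by lra.
have [v bv dv] := aV _ e2; have [w bw dw] := aW _ e2.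
exists (fun x => v x || w x); first exact: finitary2.
rewrite (_ : [set x | _] = [set x | v x] `|` [set x | w x]).
  apply: le_trans (sdistU _ mV mW (finitary_measurable bv) (finitary_measurable bw)) _; lra.
by apply/seteqP; split => x /= => [/orP|[] ->]; rewrite ?orbT.
Qed.

Lemma approx_bigcup (V : nat -> set (cube A)) : (forall n, approx (V n)) ->
  approx (\bigcup_n V n).
Proof.
move=> aV; have mV n : measurable (V n) by have [] := aV n.
have mU : measurable (\bigcup_n V n) by exact: bigcup_measurable.
split => // e e0; have e2 : 0 < e / 2 by lra.
have [N tailN] := prob_bigcup_tail mu mV e2.
set B := \big[setU/set0]_(n < N) V n in tailN.
have [mB aB] : approx B.
  rewrite /B; elim: N {tailN B} => [|N IH].
    rewrite big_ord0; split; first exact: measurable0.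
    move=> e' e'0; exists (fun=> false); first exact: finitary_cst.
    rewrite (_ : [set x | _] = set0) ?sdistvv ?ltW //.
    by apply/seteqP; split.
  by rewrite big_ord_recr /=; exact: approxU.
have [v bv dv] := aB _ e2; exists v => //.
apply: le_trans (sdist_triangle _ mU mB (finitary_measurable bv)) _.
rewrite {1}/sdist (_ : B `\` \bigcup_n V n = set0) ?prob_set0 ?addr0; first lra.
apply/seteqP; split => x //= -[]; rewrite /B -bigcup_mkord => -[n _ Vn].
by case; exists n.
Qed.

(** The events that can be approximated form a sigma-algebra containing the
    coordinate events. *)
Lemma approx_measurable V : measurable V -> approx V.
Proof.
move=> mV; have sub : @coord_sets A `<=` approx.
  move=> _ [i _ <-]; split; first exact: (measurable_coord i true).
  move=> e e0; exists (fun x => x i); first exact: finitary_coord.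
  by rewrite sdistvv ltW.
apply: (smallest_sub _ sub) mV; split.
- split; first exact: measurable0.
  move=> e' e'0; exists (fun=> false); first exact: finitary_cst.
  rewrite (_ : [set x | _] = set0) ?sdistvv ?ltW //.
  by apply/seteqP; split.
- move=> W [mW aW]; rewrite setTD; split; first exact: measurableC.
  move=> e /aW[w bw dw]; exists (fun x => ~~ w x); first exact: finitary1.
  rewrite (_ : [set x | _] = ~` [set x | w x]) ?sdistC_set //.
  by apply/seteqP; split => x /= /negP.
- exact: approx_bigcup.
Qed.

(** Finitary events are stable under intersection and generate the sigma-algebra. *)
Lemma measure_finitary_unique (nu : {measure set (cube A) -> \bar R}) :
  (forall v : (_ -> bool) -> bool, finitary v -> nu [set x | v x] = mu [set x | v x]) ->
  forall V, measurable V -> nu V = mu V.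
Proof.
move=> h V mV; apply/esym.
apply: (@measure_unique _ R (cube A) [set [set x : cube A | v x] | v in @finitary A bool] (fun=> setT)) => //.
- apply/seteqP; split.
    apply: smallest_sub; first exact: smallest_sigma_algebra.
    move=> _ [i _ <-]; apply: sub_gen_smallest.
    by exists (fun x => x i) => //; exact: finitary_coord.
  apply: smallest_sub; first exact: sigma_algebra_measurable.
  by move=> _ [v bv <-]; exact: finitary_measurable.
- move=> _ _ [v bv <-] [w bw <-]; exists (fun x => v x && w x).
    exact: finitary2.
  by apply/seteqP; split => x /= /andP.
- move=> _; exists (fun=> true); first exact: finitary_cst.
  by apply/seteqP; split.
- by rewrite bigcup_const.
- by move=> _ [v bv <-]; rewrite h.
- by move=> _ /=; rewrite probability_setT ltry.
Qed.

End Approximation.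

(** * Invariance, mixing and freeness *)

Section Dynamics.
Variables (R : realType) (G : groupType) (t : tower G).
Local Notation D := (levels (cuts t)).
Local Notation E := (window t).
Local Notation B := (D 0%N).
Local Notation I := (nat * G)%type.
Local Notation L := (@mean R G t).
Variable mu : probability (cube I) R.
Hypothesis muE : forall v : (_ -> bool) -> bool, finitary v ->
  mu [set x | v x] = (L (fun x => (v x)%:R))%:E.
Local Notation pr := (prob mu).
Local Notation pdist := (sdist mu).
Local Notation T := (@gshift G).

Lemma prob_finitary (v : (I -> bool) -> bool) :
  finitary v -> pr [set x | v x] = L (fun x => (v x)%:R).
Proof. by move=> bv; rewrite /prob muE. Qed.

Lemma measurable_shift g : measurable_fun [set: cube I] (T g : cube I -> cube I).
Proof.
apply: measurable_to_cube => i.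
exact: (measurable_coord (i.1, g^-1 * i.2)%g true).
Qed.

Lemma shift_comp g h x : T g (T h x) = T (g * h)%g x.
Proof. by apply/funext => i; rewrite /gshift /= invgM mulgA. Qed.

Lemma shift1 x : T 1%g x = x.
Proof. by apply/funext => -[m g]; rewrite /gshift /= invg1 mul1g. Qed.

Lemma shiftK g : cancel (T g) (T g^-1).
Proof. by move=> x; rewrite shift_comp mulVg shift1. Qed.

Lemma shiftVK g : cancel (T g^-1) (T g).
Proof. by move=> x; rewrite shift_comp mulgV shift1. Qed.

Lemma shift_image g (V : set (I -> bool)) : T g @` V = T g^-1 @^-1` V.
Proof.
apply/seteqP; split => [_ [x Vx <-]|x Vx]; rewrite /preimage /= ?shiftK //.
by exists (T g^-1 x) => //; rewrite shiftVK.
Qed.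

(** Both sides agree on finitary events by mean_shift. *)
Lemma mu_shift g (V : set (cube I)) : measurable V -> mu (T g @^-1` V) = mu V.
Proof.
move=> mV; pose f : {mfun cube I >-> cube I} := mfun_Sub (mem_set (measurable_shift g)).
apply: (@measure_finitary_unique R I mu (distribution mu f)) => // v bv.
rewrite muE // -(mean_shift t g); last exact: finitary_natr.
by rewrite -(muE (finitary_shift g bv)).
Qed.

Lemma measurable_shift_pre g (V : set (cube I)) : measurable V ->
  measurable (T g @^-1` V : set (cube I)).
Proof. by move=> mV; rewrite -[X in measurable X]setTI; exact: measurable_shift. Qed.

Lemma mp_shift : mp_action mu (T : G -> cube I -> cube I).
Proof.
split; last by apply/funext => x; exact: shift1.
  move=> g; split; first exact: measurable_shift.
    exists (T g^-1); split; [exact: shiftK|exact: shiftVK|exact: measurable_shift].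
  exact: mu_shift.
by move=> g h; apply/funext => x; exact: shift_comp.
Qed.

Lemma prob_shift g (V : set (cube I)) : measurable V -> pr (T g @^-1` V) = pr V.
Proof. by move=> mV; rewrite /prob mu_shift. Qed.

Lemma sdist_shift g (V W : set (cube I)) : measurable V -> measurable W ->
  pdist (T g @^-1` V) (T g @^-1` W) = pdist V W.
Proof.
move=> mV mW; rewrite /sdist; congr (_ + _).
  exact: (prob_shift g (measurableD mV mW)).
exact: (prob_shift g (measurableD mW mV)).
Qed.

Hypothesis Ginf : infinite_set [set: G].
Local Notation frechet := (@frechet_filter G : set_system G).

Lemma injective_escapes (u : G -> G) (W : seq G) : injective u ->
  \forall h \near frechet, u h \notin W.
Proof.
move=> uinj; rewrite /prop_near1 /nbhs /= /frechet_filter /=.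
apply: (@sub_finite_set _ _ (u @^-1` [set` W])).
  by move=> h /= /negP; rewrite negbK.
apply: finite_preimage; last exact: finite_seq.
by move=> x y _ _; exact: uinj.
Qed.

(** By linearity f may be taken to be a character, and then escaping_decorrelates
    applies to its translates. *)
Lemma translate_decorrelates f f' : finitary f -> finitary f' ->
  (L (fun x => f (T g^-1 x) * f' x) - L f * L f') @[g --> frechet] --> (0 : R).
Proof.
have FF := frechet_properfilter Ginf.
move=> + df'; move: f; apply: finitary_ind => [l|p q f1 f2 d1 d2 c1 c2].
  have := @escaping_decorrelates R G t Ginf (fun g => translate g l) (size l) _ _ f' df'.
  rewrite (_ : (fun h => _) = (fun g => L (fun x => chi l (T g^-1 x) * f' x) -
      L (chi l) * L f')).
    apply=> [h|W]; first by rewrite size_map.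
    elim: l => [|i l IH]; first by near=> h.
    near=> h => /=; apply/andP; split; last by near: h.
    near: h; apply: (injective_escapes (u := fun h => h * i.2)%g) => x y; exact: mulIg.
  apply/funext => g; rewrite mean_translate; congr (L _ - _).
  by apply/funext => x; rewrite chi_shift invgK.
have dT (f : (I -> bool) -> R) g : finitary f -> finitary (fun x => f (T g^-1 x) * f' x).
  by move=> df; apply: (finitary2 (fun u v : R => u * v)) => //; exact: (finitary_shift g^-1 df).
rewrite (_ : (fun g => _) = fun g =>
   p * (L (fun x => f1 (T g^-1 x) * f' x) - L f1 * L f') +
   q * (L (fun x => f2 (T g^-1 x) * f' x) - L f2 * L f')); last first.
  apply/funext => g; rewrite mean_lin //.
  rewrite (_ : (fun x => _) = fun x => p * (f1 (T g^-1 x) * f' x) + q * (f2 (T g^-1 x) * f' x)).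
    rewrite mean_lin; first by ring.
    exact: dT. exact: dT.
  by apply/funext => x; ring.
rewrite -[X in _ --> X](_ : p * 0 + q * 0 = 0); last by rewrite !mulr0 addr0.
by apply: cvgD; apply: cvgMr.
Unshelve. all: by end_near. Qed.

(** Both events are replaced by finitary ones, to which translate_decorrelates
    applies. *)
Lemma mixing_shift : mixing mu (T : G -> cube I -> cube I).
Proof.
have FF := frechet_properfilter Ginf.
move=> V W mV mW.
have mTg g (Z : set (cube I)) : measurable Z -> measurable (T g^-1 @^-1` Z : set (cube I)).
  exact: measurable_shift_pre.
rewrite (probE mu mV) (probE mu mW) -EFinM.
rewrite (_ : (fun g => _) = fun g => (pr ((T g^-1 @^-1` V) `&` W))%:E); last first.
  apply/funext => g; rewrite -probE; last by apply: measurableI => //; exact: mTg.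
  by congr (mu (_ `&` _)); exact: shift_image.
apply: cvg_EFin; first by near=> g.
apply/cvgrPdist_le => e e0.
have e5 : 0 < e / 5 by lra.
have [_ /(_ _ e5)[v bv dv]] := approx_measurable mu mV.
have [_ /(_ _ e5)[w bw dw]] := approx_measurable mu mW.
set v' := [set x : cube I | v x] in dv; set w' := [set x : cube I | w x] in dw.
have mv : measurable v' by exact: finitary_measurable.
have mw : measurable w' by exact: finitary_measurable.
have := translate_decorrelates (finitary_natr R bv) (finitary_natr R bw).
move=> /cvgrPdist_le /(_ _ e5) main.
near=> g.
have mg : `|0 - (L (fun x => (v (T g^-1 x))%:R * (w x)%:R) -
    L (fun x => (v x)%:R) * L (fun x => (w x)%:R))| <= e / 5 by near: g.
have {mg} : `|pr ((T g^-1 @^-1` v') `&` w') - pr v' * pr w'| <= e / 5.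
  rewrite (_ : _ `&` _ = [set x | v (T g^-1 x) && w x]).
    rewrite !prob_finitary //; last by apply: finitary2 => //; exact: finitary_shift.
    move: mg; rewrite sub0r normrN; congr (`|_ - _| <= _); congr mean.
    by apply/funext => x; case: (v _); case: (w _); rewrite ?mulr0 ?mulr1.
  by apply/seteqP; split => x /=; rewrite /v' /w' /= => /andP.
have := prob_sdist mu (measurableI _ _ (mTg g _ mV) mW) (measurableI _ _ (mTg g _ mv) mw).
have := sdistI mu (mTg g _ mV) mW (mTg g _ mv) mw; rewrite sdist_shift //.
have := prob_sdist mu mV mv; have := prob_sdist mu mW mw.
have bnd (Z : set (cube I)) : measurable Z -> 0 <= pr Z <= 1.
  by move=> mZ; rewrite prob_ge0 -(prob_setT mu) prob_le.
have /andP[p0 p1] := bnd _ mV; have /andP[q0 q1] := bnd _ mw.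
rewrite !ler_norml => /andP[a1 a2] /andP[b1 b2] c /andP[d1 d2] /andP[m1 m2].
set x1 := pr (_ `&` W) in d1 d2 *; set x2 := pr (_ `&` w') in d1 d2 m1 m2.
set pV := pr V in a1 a2 b1 b2 p0 p1 *; set pW := pr W in a1 a2 b1 b2 *.
set pv := pr v' in b1 b2 m1 m2; set pw := pr w' in a1 a2 m1 m2 q0 q1.
have k : `|pV * pW - pv * pw| <= e / 5 + e / 5.
  rewrite (_ : _ - _ = pV * (pW - pw) + (pV - pv) * pw); last by ring.
  apply: le_trans (ler_normD _ _) _; rewrite !normrM (ger0_norm p0) (ger0_norm q0).
  have z1 : `|pW - pw| <= e / 5 by rewrite ler_norml; apply/andP; split; lra.
  have z2 : `|pV - pv| <= e / 5 by rewrite ler_norml; apply/andP; split; lra.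
  apply: lerD.
    by rewrite -[leRHS]mul1r; apply: ler_pM.
  by rewrite -[leRHS]mulr1; apply: ler_pM.
rewrite /= -/x1; move: k; rewrite ler_norml => /andP[k1 k2]; apply/andP; split; lra.
Unshelve. all: by end_near. Qed.

Lemma odds_site n i : odds (expand t n [:: i]) = size (D i.1 n).
Proof.
rewrite /expand /= cats0 odds_uniq ?size_map //.
by rewrite map_inj_uniq ?level_uniq_gen //; exact: mulgI.
Qed.

Definition pair_sites (g h : G) : seq I := [:: (0%N, h); (0%N, g^-1 * h)%g].

(** The sets h B_0 and g^-1 h B_0 have measure 1 and meet in measure at most 2/3,
    since h^-1 g h is not 1; so their symmetric difference has measure at least
    2/3. *)
Lemma mean_pair_sites g h : g != 1%g -> L (chi (pair_sites g h)) <= expR (- (2 / 3)).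
Proof.
move=> g1; have [N hN] := mean_chi R t (pair_sites g h).
have kE : (((0%N, g^-1 * h).2)^-1 * (0%N, h).2)%g \notin E 0.
  rewrite /= window0 inE invgM invgK; apply: contra g1 => /eqP e.
  have {}e : (h^-1 * g = h^-1)%g by apply: (mulIg h); rewrite e mulVg.
  by apply/eqP/(mulgI h^-1%g); rewrite e mulg1.
have [N' hN'] := overlap_decay kE.
set n := maxn N N'; rewrite (hN n) ?leq_maxl // ler_expR lerN2.
have := hN' n (leq_maxr _ _).
have := odds_cat (expand t n [:: (0%N, h)]) (expand t n [:: (0%N, g^-1 * h)%g]).
rewrite !odds_site -expand_cat /= => /andP[_].
have := common_expand t n [:: (0%N, h)] [:: (0%N, g^-1 * h)%g].
rewrite !big_seq1 -/(pair_sites g h).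
set o := odds _; set c := common _ _; set ov := overlap _ _; set sB := size _ => h1 h2 h3.
have b0 : 0 < sB%:R :> R by rewrite ltr0n size_level_gt0.
rewrite ler_pdivlMr //.
have : (2 * sB <= 3 * o)%N by lia.
rewrite -(ler_nat R) !natrM; lra.
Qed.

(** Let F be the set of fixed points of g, and V a finitary event close to F. The sign
    product of pair_sites g h is 1 on F, so its integral over V is close to the
    probability of V; for h far away that integral is close to at most r times this
    probability, with r = exp (- 2/3) < 1. So V has small probability. *)
Lemma free_shift (I_countable : countable [set: I]) :
  free_action mu (T : G -> cube I -> cube I).
Proof.
have FF := frechet_properfilter Ginf.
move=> g /eqP g1; set F : set (cube I) := [set x | T g x = x].
have mF : measurable F.
  rewrite (_ : F = \bigcap_(i in [set: I]) [set x | x (i.1, g^-1 * i.2)%g = x i]).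
    rewrite -[X in measurable X]setCK setC_bigcap; apply: measurableC.
    apply: countable_bigcupT_measurable => // i; apply: measurableC.
    have bi : finitary (fun x : I -> bool => x (i.1, g^-1 * i.2)%g == x i).
      by apply: (finitary2 (fun u v => u == v)); exact: finitary_coord.
    rewrite (_ : mkset _ = [set x : cube I | x (i.1, g^-1 * i.2)%g == x i]).
      exact: (finitary_measurable bi).
    by apply/seteqP; split => x /= /eqP.
  apply/seteqP; split => x /=; first by move=> Tx i _ /=; rewrite -[in RHS]Tx.
  by move=> h; apply/funext => i; exact: (h i).
suff F0 : pr F = 0 by exists F; split => //; rewrite (probE mu mF) F0.
apply/eqP; rewrite eq_le prob_ge0 andbT; apply/ler_addgt0Pl => e e0; rewrite addr0.
pose r : R := expR (- (2 / 3)).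
have r1 : r < 1 by rewrite -expR0 ltr_expR; lra.
(* The error terms below add up to 3 e' = (1 - r) (3 e / 4). *)
pose e' := (1 - r) * e / 4.
have e'0 : 0 < e' by rewrite /e' divr_gt0 // mulr_gt0 // subr_gt0.
have [_ /(_ _ e'0)[v bv dv]] := approx_measurable mu mF.
have mv := finitary_measurable bv; set V := [set x : cube I | v x] in dv mv.
have esc (W : seq G) : \forall h \near frechet, all (fun i => i.2 \notin W) (pair_sites g h).
  near=> h => /=; rewrite andbT; apply/andP; split; near: h.
    exact: (@injective_escapes id).
  by apply: (@injective_escapes (fun h => g^-1 * h)%g) => x y; exact: mulgI.
have sz h : (size (pair_sites g h) <= 2)%N by [].
have /cvgrPdist_le /(_ _ e'0) main := escaping_decorrelates t Ginf sz esc (finitary_natr R bv).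
have [h] := @filter_ex _ _ FF _ main; rewrite sub0r normrN.
have := mean_pair_sites h g1; rewrite -/r => rL.
pose odd_pair (x : I -> bool) := x (0%N, h) (+) x (0%N, g^-1 * h)%g.
have bo : finitary (fun x => v x && odd_pair x).
  by apply: finitary2 => //; apply: finitary2; exact: finitary_coord.
(* A sign is 1 - 2 b. *)
rewrite (_ : (fun x => chi _ x * _) = fun x => 1 * (v x)%:R + (- 2) * (v x && odd_pair x)%:R); last first.
  apply/funext => x; rewrite /pair_sites !chi_cons chi_nil mulr1 -signr_addb -/(odd_pair x).
  by case: (v x); case: (odd_pair x); rewrite /= ?expr1 ?expr0; ring.
rewrite mean_lin -?prob_finitary //; try exact: finitary_natr.
pose W : set (cube I) := [set x | v x && odd_pair x].
rewrite -/V -/W; have mW : measurable W by exact: finitary_measurable.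
have WF : W `<=` V `\` F.
  move=> x /= /andP[vx ox]; split => // Fx; move: ox; rewrite /odd_pair.
  by rewrite -{1}Fx /gshift /= addbb.
have := prob_le mu mW (measurableD mv mF) WF.
have := prob_sub_le mu mF mv; move: dv; rewrite /sdist.
have := prob_ge0 mu (F `\` V); have := prob_ge0 mu (V `\` F).
have := prob_ge0 mu V; have := prob_ge0 mu W.
have l0 : L (chi (pair_sites g h)) * pr V <= r * pr V by rewrite ler_wpM2r // prob_ge0.
rewrite ler_norml => w0 v0 a0 b0 ab c d /andP[k1 k2].
have : (1 - r) * pr V <= 3 * e' by lra.
have -> : 3 * e' = (1 - r) * (3 / 4 * e) by rewrite /e'; field.
rewrite ler_pM2l ?subr_gt0 // => ve.
have : e' <= e / 4.
  rewrite /e' ler_pM2r ?invr_gt0 // -[leRHS]mul1r ler_pM2r // lerBlDr lerDl expR_ge0.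
  by [].
lra.
Unshelve. all: by end_near. Qed.

End Dynamics.

(** * Counting in Folner sets *)

Section FolnerCount.
Variables (R : realType) (G : groupType).

(** The inverses of the elements g^-1 k are the k^-1 g, and each k^-1 F differs from F
    only by elements of the symmetric difference. *)
Lemma folner_cover (F : {fset G}) (K : seq G) : exists Y : {fset G},
  (forall g k, g \in F -> k \in K -> (g^-1 * k)%g \in Y) /\
  (#|` Y| <= #|` F| + \sum_(k <- K) #|` fsymdiff (ltranslate k^-1 F) F|)%N.
Proof.
suff [Z [FZ KZ cZ]] : exists Z : {fset G}, [/\ (F `<=` Z)%fset,
    forall g k, g \in F -> k \in K -> (k^-1 * g)%g \in Z &
    (#|` Z| <= #|` F| + \sum_(k <- K) #|` fsymdiff (ltranslate k^-1 F) F|)%N].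
  exists [fset (z^-1)%g | z in Z]%fset; split.
    move=> g k gF kK; apply/imfsetP; exists (k^-1 * g)%g; first exact: KZ.
    by rewrite invgM invgK.
  by apply: leq_trans cZ; rewrite card_imfset //=; exact: invg_inj.
elim: K => [|k K [Z [FZ KZ cZ]]].
  by exists F; split; rewrite ?big_nil ?addn0 // => g k.
exists (Z `|` fsymdiff (ltranslate k^-1 F) F)%fset; split.
- exact: fsubset_trans FZ (fsubsetUl _ _).
- move=> g k' gF; rewrite in_cons => /predU1P[->|k'K]; last by rewrite inE KZ.
  have kg : (k^-1 * g)%g \in ltranslate k^-1 F by apply/imfsetP; exists g.
  rewrite inE; have [kF|kF] := boolP ((k^-1 * g)%g \in F).
    by rewrite (fsubsetP FZ).
  by rewrite /fsymdiff !inE kF kg orbT.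
- rewrite big_cons addnCA [leqRHS]addnC; rewrite cardfsU addnC.
  by apply: leq_trans (leq_subr _ _) _; rewrite addnC leq_add2r.
Qed.

Lemma folner_near (F : nat -> {fset G}) (K : seq G) : folner R F ->
  \forall n \near \oo,
   (\sum_(k <- K) #|` fsymdiff (ltranslate k^-1 (F n)) (F n)| <= #|` F n|)%N.
Proof.
move=> [F0 FF].
have : (fun n => \sum_(k <- K) (#|` fsymdiff (ltranslate k^-1 (F n)) (F n)|%:R / #|` F n|%:R : R))
   @ \oo --> (0 : R).
  elim: K => [|k K IH].
    by rewrite (_ : (fun n => _) = fun=> 0); [exact: cvg_cst|apply/funext => n; rewrite big_nil].
  rewrite (_ : (fun n => _) = fun n => #|` fsymdiff (ltranslate k^-1 (F n)) (F n)|%:R / #|` F n|%:R +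
    \sum_(k <- K) (#|` fsymdiff (ltranslate k^-1 (F n)) (F n)|%:R / #|` F n|%:R : R)).
    by rewrite -[X in _ --> X]addr0; apply: cvgD.
  by apply/funext => n; rewrite big_cons.
move=> /cvgrPdist_le /(_ 1 ltr01); apply: filterS => n /=.
rewrite sub0r normrN -mulr_suml -natr_sum ger0_norm ?divr_ge0 //.
by rewrite ler_pdivrMr ?mul1r ?ler_nat // ltr0n cardfs_gt0.
Qed.

End FolnerCount.

(** * Zero entropy *)

Section ZeroEntropy.
Variables (R : realType) (G : groupType) (t : tower G).
Local Notation D := (levels (cuts t)).
Local Notation E := (window t).
Local Notation B := (D 0%N).
Local Notation I := (nat * G)%type.
Local Notation L := (@mean R G t).
Variable mu : probability (cube I) R.
Hypothesis muE : forall v : (_ -> bool) -> bool, finitary v ->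
  mu [set x | v x] = (L (fun x => (v x)%:R))%:E.
Local Notation pr := (prob mu).
Local Notation pdist := (sdist mu).
Local Notation ent := (entropy mu).
Local Notation T := (@gshift G).

Lemma prob_odd_parity (i : I) (l : seq I) :
  pr [set x : cube I | odd (count x (i :: l))] = (1 - L (chi (i :: l))) / 2.
Proof.
have bv : finitary (fun x : I -> bool => odd (count x (i :: l))).
  by exists (i :: l) => x y xy; rewrite (eq_in_count xy).
rewrite (prob_finitary muE bv).
rewrite (_ : (fun x => _) = fun x => 2^-1 * 1 + (- 2^-1) * chi (i :: l) x).
  by rewrite mean_lin ?mean1; [field|exact: finitary_cst|exact: finitary_chi].
apply/funext => x; rewrite /chi -signr_odd.
by case: (odd _); rewrite /= ?expr1 ?expr0; field.
Qed.

(** The probability is (1 - exp (- nu (B_M))) / 2, and nu (B_M) = 1 / |S_M|. *)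
Lemma prob_site M k : pr [set x : cube I | x (M, k)] <= (M.+1%:R)^-1.
Proof.
have [N hN] := mean_chi R t [:: (M, k)].
have b0 n : 0 < (size (B n))%:R :> R by rewrite ltr0n size_level_gt0.
have dn0 n : (size (D M n))%:R != 0 :> R by rewrite pnatr_eq0 -lt0n size_level_gt0.
have Lk : L (chi [:: (M, k)]) = expR (- ((size (B M))%:R)^-1).
  rewrite (hN (maxn N M)) ?leq_maxl // odds_site /= (size_level_comp t (leq_maxr N M)) natrM.
  by congr (expR (- _)); rewrite invfM mulrCA divff ?mulr1.
rewrite (_ : [set x | _] = [set x : cube I | odd (count x [:: (M, k)])]); last first.
  by apply/seteqP; split => x /=; rewrite addn0 oddb.
rewrite prob_odd_parity Lk.
have := expR_ge1Dx (- ((size (B M))%:R)^-1 : R).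
have : ((size (B M))%:R)^-1 <= (M.+1%:R)^-1 :> R.
  by rewrite lef_pV2 ?posrE ?ltr0n ?size_level_gt0 // ler_nat size_level_ge.
have : 0 <= (M.+1%:R)^-1 :> R by rewrite invr_ge0.
set w := (M.+1%:R)^-1; set u := ((size (B M))%:R)^-1; set p := expR _.
move: w u p => w u p; lra.
Qed.

(** The bits of levels up to M, recomputed from those of level M. *)
Definition refine M (x : I -> bool) : I -> bool := fun i =>
  if (i.1 <= M)%N then odd (count x [seq (M, i.2 * d)%g | d <- D i.1 M]) else x i.

(** At late stages a site and its refinement look at the same list of places, so the
    character of the two together is 1 in the mean. *)
Lemma prob_refine M i : (i.1 <= M)%N -> pr [set x : cube I | x i != refine M x i] = 0.
Proof.
move=> iM; set l := [seq (M, i.2 * d)%g | d <- D i.1 M].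
rewrite (_ : [set x | _] = [set x : cube I | odd (count x (i :: l))]); last first.
  apply/seteqP; split => x /=; rewrite /refine iM -/l oddD oddb.
    by case: (x i); case: (odd _).
  by case: (x i); case: (odd _).
rewrite prob_odd_parity.
have [N hN] := mean_chi R t (i :: l).
rewrite (hN (maxn N M)) ?leq_maxl // -[i :: l]/([:: i] ++ l) expand_cat.
have -> : expand t (maxn N M) [:: i] = expand t (maxn N M) l.
  by case: i @l iM {hN} => m g l iM; apply: expand_refine; rewrite iM leq_maxr.
by rewrite odds_double mul0r oppr0 expR0 subrr mul0r.
Qed.

Lemma fin_rv_depends (J : finType) s (q : cube I -> J) : depends_on s q -> fin_rv q.
Proof.
by move=> dq j; apply: (@measurable_dep _ s) => x y xy /= <-; rewrite (dq x y).
Qed.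

Lemma approx_fin_rv (J : finType) (f : cube I -> J) (dl : R) : fin_rv f -> 0 < dl ->
  exists s (q : cube I -> J), depends_on s q /\ pr [set x | f x != q x] <= dl.
Proof.
move=> mf dl0.
have [j0 _|noJ] := pickP (fun _ : J => true); last first.
  exists [::], f; split; first by move=> x; have := noJ (f x).
  rewrite (_ : [set x | _] = set0) ?prob_set0 ?ltW //.
  by apply/seteqP; split => x //=; rewrite eqxx.
pose e := dl / #|J|%:R.
have cJ : 0 < #|J|%:R :> R by rewrite ltr0n; apply/card_gt0P; exists j0.
have e0 : 0 < e by rewrite divr_gt0.
have /choice[v vP] : forall j, exists v : (_ -> bool) -> bool, finitary v /\
    pdist [set x | f x = j] [set x | v x] <= e.
  move=> j; have [_ /(_ _ e0)[v bv dv]] := approx_measurable mu (mf j).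
  by exists v.
have /choice[s sP] : forall j, exists s : seq I, forall x y, {in s, x =1 y} -> v j x = v j y.
  by move=> j; have [[s sv] _] := vP j; exists s.
(* Where the approximations are all correct, exactly one v j holds, namely that of
   j = f x. *)
pose q (x : cube I) := odflt j0 [pick j | v j x].
have dq : depends_on (flatten [seq s j | j <- enum J]) q.
  move=> x y xy; congr (odflt _); apply: eq_pick => j; apply: sP => i si.
  by apply: xy; apply/flatten_mapP; exists j => //; rewrite mem_enum.
exists (flatten [seq s j | j <- enum J]), q; split => //.
have mq : fin_rv q := fin_rv_depends dq.
have mv j : measurable [set x : cube I | v j x] by apply: finitary_measurable; have [] := vP j.
pose W j := ([set x | f x = j] `\` [set x | v j x]) `|` ([set x | v j x] `\` [set x | f x = j]).
have mW j : measurable (W j) by apply: measurableU; apply: measurableD.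
apply: (@le_trans _ _ (pr (\big[setU/set0]_(j <- enum J) W j))).
  apply: prob_le.
  - exact: (fin_rv_pred (fun jk : J * J => jk.1 != jk.2) (fin_rv_pair mf mq)).
  - exact: bigsetU_measurable.
  move=> x /= fq; rewrite -bigcup_seq; apply: contrapT => nW; case/negP: fq; apply/eqP.
  have vE j : v j x = (f x == j).
    apply: contrapT => vj; apply: nW; exists j; first by rewrite /= mem_enum.
    rewrite /W /=; have [fj|nfj] := eqVneq (f x) j; [left|right]; split => //.
    - by move=> vjx; apply: vj; rewrite vjx fj eqxx.
    - by apply: contrapT => /negP/negbTE vjx; apply: vj; rewrite vjx; apply/esym/negbTE.
    - by move/eqP; rewrite (negbTE nfj).
  rewrite /q; case: pickP => [j|/(_ (f x))]; first by rewrite vE => /eqP.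
  by rewrite vE eqxx.
apply: le_trans (prob_big_le mu _ mW) _.
apply: (@le_trans _ _ (\sum_(j <- enum J) e)).
  apply: ler_sum => j _; apply: le_trans (prob_leU _ _ _) _; try by apply: measurableD.
  by have [] := vP j.
rewrite big_enum /= sumr_const -[leLHS]mulr_natl cardE -cardE /e.
by rewrite mulrCA divff ?mulr1 ?gt_eqF.
Qed.

(** A function of finitely many sites is almost surely a function of sites of one
    level M, which may be as large as desired. *)
Lemma approx_level (J : finType) (f : cube I -> J) (dl : R) (M0 : nat) :
  fin_rv f -> 0 < dl -> exists M K (q : cube I -> J), [/\ (M0 <= M)%N,
    depends_on [seq (M, k) | k <- K] q, fin_rv q & pr [set x | f x != q x] <= dl].
Proof.
move=> mf dl0; have [s [q [dq fq]]] := approx_fin_rv mf dl0.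
pose M := (M0 + \sum_(i <- s) i.1)%N.
have sM i : i \in s -> (i.1 <= M)%N.
  by move=> si; rewrite /M (big_rem i) //= addnCA leq_addr.
(* The places of level M that the refinements of the sites of s look at. *)
pose K := [seq (i.2 * d)%g | i <- s, d <- D i.1 M].
pose q' (x : cube I) := q (refine M x).
have dq' : depends_on [seq (M, k) | k <- K] q'.
  move=> x y xy; apply: dq => i si; rewrite /refine (sM i si); congr (odd _).
  rewrite !count_map; apply: eq_in_count => d dD /=; apply: xy.
  by apply: map_f; apply/allpairsPdep; exists i, d.
have mq' : fin_rv q' := fin_rv_depends dq'.
have mq : fin_rv q := fin_rv_depends dq.
exists M, K, q'; split => //; first exact: leq_addr.
have mneq (g g' : cube I -> J) : fin_rv g -> fin_rv g' -> measurable [set x | g x != g' x].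
  by move=> mg mg'; exact: (fin_rv_pred (fun jk : J * J => jk.1 != jk.2) (fin_rv_pair mg mg')).
have qq' : pr [set x | q x != q' x] <= 0.
  pose W i := [set x : cube I | (i \in s) && (x i != refine M x i)].
  have mW i : measurable (W i).
    have [si|si] := boolP (i \in s); last first.
      rewrite (_ : W i = set0); first exact: measurable0.
      by apply/seteqP; split => x //; rewrite /W /= (negbTE si).
    apply: (@measurable_dep _ (i :: [seq (M, i.2 * d)%g | d <- D i.1 M])) => x y xy.
    rewrite /W /= /refine (sM i si) (xy i (mem_head _ _)).
    by rewrite (@eq_in_count _ x y) // => j jl; apply: xy; rewrite in_cons jl orbT.
  apply: (@le_trans _ _ (pr (\big[setU/set0]_(i <- s) W i))).
    apply: prob_le; [exact: mneq|exact: bigsetU_measurable|].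
    move=> x /= nq; rewrite -bigcup_seq; apply: contrapT => nW; case/negP: nq; apply/eqP.
    apply: dq => i si; apply: contrapT => /eqP ne; apply: nW; exists i => //.
    by rewrite /W /= si.
  apply: le_trans (prob_big_le mu _ mW) _; rewrite big_seq big1 // => i si.
  by rewrite /W si /= prob_refine // sM.
rewrite -[leRHS]addr0; apply: le_trans (lerD fq qq').
apply: le_trans (prob_leU _ _ _) ; try exact: mneq.
apply: prob_le; [exact: mneq|by apply: measurableU; exact: mneq|].
move=> x /=; have [<-|] := eqVneq (f x) (q x); first by right.
by left.
Qed.

Lemma fin_rv_shift (J : finType) (f : cube I -> J) g :
  fin_rv f -> fin_rv (fun x : cube I => f (T g x)).
Proof. by move=> mf j; exact: (measurable_shift_pre g (mf j)). Qed.

(** The values f (T g x), g in F, are recovered from the bits of level M at the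
    places of Y, which give q (T g x), and from the error variables N (T g x), which
    are silent unless f and q disagree. *)
Lemma entropy_join_le (J : finType) (f q : cube I -> J) (F Y : {fset G}) M K (d1 d2 : R) :
  fin_rv f -> fin_rv q -> depends_on [seq (M, k) | k <- K] q ->
  (forall g k, g \in F -> k \in K -> (g^-1 * k)%g \in Y) ->
  pr [set x | f x != q x] <= d1 -> (M.+1%:R)^-1 <= d2 ->
  ent (fun x : cube I => [ffun g : F => f (T (val g) x)] : {ffun F -> J}) <=
    #|` Y|%:R * (2 * #|{: bool}|%:R * Num.sqrt d2 + d2) +
    #|` F|%:R * (2 * #|{: option J}|%:R * Num.sqrt d1 + d1).
Proof.
move=> mf mq dq FY fq Md2.
pose N (x : cube I) : option J := if f x == q x then None else Some (f x).
have mN : fin_rv N.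
  exact: (fin_rv_comp (fun jk : J * J => if jk.1 == jk.2 then None else Some jk.1)
    (fin_rv_pair mf mq)).
pose bits (x : cube I) : {ffun Y -> bool} := [ffun y : Y => x (M, val y)].
pose errs (x : cube I) : {ffun F -> option J} := [ffun g : F => N (T (val g) x)].
(* A family of bits with the prescribed values at level M; q does not look at the
   other coordinates. *)
pose ext (c : {ffun Y -> bool}) : cube I := fun i => if insub i.2 is Some y then c y else false.
pose dec (cn : {ffun Y -> bool} * {ffun F -> option J}) : {ffun F -> J} :=
  [ffun g : F => if cn.2 g is Some j then j else q (T (val g) (ext cn.1))].
have mbit (y : Y) : fin_rv (fun x : cube I => x (M, val y)).
  by move=> c; exact: measurable_coord.
have mbits : fin_rv bits by exact: fin_rv_ffun.
have merr (g : F) : fin_rv (fun x : cube I => N (T (val g) x)) by exact: fin_rv_shift.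
have merrs : fin_rv errs by exact: fin_rv_ffun.
have -> : (fun x : cube I => [ffun g : F => f (T (val g) x)] : {ffun F -> J}) =
    dec \o (fun x => (bits x, errs x)).
  apply/funext => x; apply/ffunP => g; rewrite /dec /= !ffunE /N.
  case: eqP => // ->; apply: dq => _ /mapP[k kK ->].
  rewrite /gshift /ext /=; case: insubP => [y _ yE|]; first by rewrite /bits ffunE yE.
  by rewrite FY // (valP g).
apply: le_trans (entropy_comp _ _ (fin_rv_pair mbits merrs)) _.
apply: le_trans (entropy_pair _ mbits merrs) _.
apply: lerD.
  apply: le_trans (entropy_ffun _ mbit) _.
  apply: (@le_trans _ _ (\sum_(y : Y) (2 * #|{: bool}|%:R * Num.sqrt d2 + d2))).
    apply: ler_sum => y _; apply: (entropy_concentrated (j0 := false)) => //.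
    apply: le_trans Md2; apply: le_trans (prob_site M (val y)).
    rewrite le_eqVlt; apply/orP; left; apply/eqP; congr prob.
    by apply/seteqP; split => x /=; case: (x _).
  by rewrite sumr_const -[leLHS]mulr_natl -cardfE.
apply: le_trans (entropy_ffun _ merr) _.
apply: (@le_trans _ _ (\sum_(g : F) (2 * #|{: option J}|%:R * Num.sqrt d1 + d1))).
  apply: ler_sum => g _; apply: (entropy_concentrated (j0 := None)) => //.
  apply: le_trans fq;
    rewrite -(prob_shift muE (val g) (fin_rv_pred (fun jk : J * J => jk.1 != jk.2) (fin_rv_pair mf mq))).
  rewrite le_eqVlt; apply/orP; left; apply/eqP; congr prob.
  by apply/seteqP; split => x; rewrite /N /preimage /=; case: (f _ == q _).
by rewrite sumr_const -[leLHS]mulr_natl -cardfE.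
Qed.

Lemma cell_function k (P : 'I_k -> set (cube I)) : measurable_partition P ->
  exists f : cube I -> 'I_k, fin_rv f /\ forall x j, P j x <-> f x = j.
Proof.
move=> [[cov triv _] mP].
have /choice[f fP] : forall x : cube I, exists j, P j x.
  move=> x; have : [set: cube I] x by [].
  by rewrite -cov => -[j _ Px]; exists j.
have fE x j : P j x <-> f x = j.
  split => [Px|<- //]; apply: (triv (f x) j) => //.
  by exists x; split => //; exact: fP.
exists f; split => // j; rewrite (_ : mkset _ = P j); first exact: mP.
by apply/seteqP; split => x /= /fE.
Qed.

(** Make the error variables of entropy at most e / 2 by the choice of d1, then the
    bits of entropy at most e / 4 by the choice of the level; for n large there are
    at most twice as many bits as elements of F n. *)
Lemma mean_entropy_cvg0 (F : nat -> {fset G}) k (P : 'I_k -> set (cube I)) :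
  folner R F -> measurable_partition P ->
  mean_entropy mu (T : G -> cube I -> cube I) F P @ \oo --> (0 : R).
Proof.
move=> FF mP; have [f [mf fP]] := cell_function mP.
have F_gt0 n : 0 < #|` F n|%:R :> R by rewrite ltr0n cardfs_gt0; exact: FF.1.
have meanE n : mean_entropy mu (T : G -> cube I -> cube I) F P n =
    ent (fun x : cube I => [ffun g : F n => f (T (val g) x)] : {ffun F n -> 'I_k}) / #|` F n|%:R.
  congr (- _ / _); apply: eq_bigr => a _.
  suff -> : join_preimages (T : G -> cube I -> cube I) P a =
      [set x | [ffun g : F n => f (T (val g) x)] = a] by [].
  apply/seteqP; split => x /=.
    by move=> h; apply/ffunP => g; rewrite ffunE; apply/fP; exact: h.
  by move=> <- g _; rewrite /= ffunE; apply/fP.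
apply/cvgrPdist_le => e e0.
have e4 : 0 < e / 4 by lra.
have e2 : 0 < e / 2 by lra.
have [d1 d10 d1e] := @sqrt_modulus R (2 * #|{: option 'I_k}|%:R) _
  (mulr_ge0 (ler0n _ 2) (ler0n _ _)) e2.
have [d2 d20 d2e] := @sqrt_modulus R (2 * #|{: bool}|%:R) _ (mulr_ge0 (ler0n _ 2) (ler0n _ _)) e4.
have [M [K [q [M0M dq mq fq]]]] := approx_level (Num.bound d2^-1) mf d10.
have Md2 : (M.+1%:R)^-1 <= d2.
  rewrite -[leRHS]invrK lef_pV2 ?posrE ?invr_gt0 ?ltr0n //.
  apply: le_trans (ltW (archi_boundP _)) _; first by rewrite invr_ge0 ltW.
  by rewrite ler_nat (leq_trans M0M).
have /(_ K) := folner_near (F := F) _ FF; apply: filterS => n Kn.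
rewrite sub0r normrN meanE.
have [Y [FY cY]] := folner_cover (F n) K.
have mJ : fin_rv (fun x : cube I => [ffun g : F n => f (T (val g) x)] : {ffun F n -> 'I_k}).
  by apply: fin_rv_ffun => g; exact: fin_rv_shift.
rewrite ger0_norm ?divr_ge0 ?entropy_ge0 // ler_pdivrMr //.
apply: le_trans (entropy_join_le mf mq dq FY fq Md2) _.
have cY2 : #|` Y|%:R <= 2 * #|` F n|%:R :> R.
  by rewrite -natrM ler_nat; apply: leq_trans cY _; rewrite mul2n -addnn leq_add2l.
apply: (@le_trans _ _ ((2 * #|` F n|%:R) * (e / 4) + #|` F n|%:R * (e / 2))).
  apply: lerD; last by rewrite ler_pM2l.
  by apply: ler_pM => //; rewrite addr_ge0 ?mulr_ge0 ?sqrtr_ge0 // ltW.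
by rewrite le_eqVlt; apply/orP; left; apply/eqP; field.
Qed.

End ZeroEntropy.

(** * The space of bits is a standard Borel space *)

(** R is the type of the radii of the balls defined below. *)
Definition binseq (R : realType) : Type := nat -> bool.

HB.instance Definition _ (R : realType) := Pointed.on (binseq R).

Section BinSeq.
Variable R : realType.
Implicit Types (x y z : binseq R) (e : R).

(** Sequences within distance e agree at all places k with e <= 1 / (k + 1). For
    e <= 0 the ball has to be empty, otherwise the triangle inequality would fail
    when one radius is negative. *)
Definition bball x e y := 0 < e /\ forall k, e <= (k.+1%:R)^-1 -> x k = y k.

Lemma bball_center x e : 0 < e -> bball x e x.
Proof. by []. Qed.

Lemma bball_sym x y e : bball x e y -> bball y e x.
Proof. by move=> [e0 h]; split => // k /h. Qed.

Lemma bball_triangle x y z e1 e2 : bball x e1 y -> bball y e2 z -> bball x (e1 + e2) z.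
Proof.
move=> [e10 h1] [e20 h2]; split; first exact: addr_gt0.
by move=> k hk; rewrite h1 ?h2 //; apply: le_trans hk; rewrite ?lerDl ?lerDr ltW.
Qed.

Definition bent : set_system (binseq R * binseq R) := entourage_ bball.

HB.instance Definition _ := hasNbhs.Build (binseq R) (nbhs_ bent).

Lemma bnbhsE : (nbhs : binseq R -> _) = nbhs_ bent. Proof. by []. Qed.

HB.instance Definition _ := @Nbhs_isPseudoMetric.Build R (binseq R)
  bent bnbhsE bball bball_center bball_sym bball_triangle erefl.

Lemma bball_agree x y K : bball x (K.+1%:R)^-1 y <-> (forall k, (k <= K)%N -> x k = y k).
Proof.
split => [[_ h] k kK|h]; first by apply: h; rewrite lef_pV2 ?posrE ?ltr0n // ler_nat.
split; first by rewrite invr_gt0 ltr0n.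
by move=> k; rewrite lef_pV2 ?posrE ?ltr0n // ler_nat ltnS; exact: h.
Qed.

Lemma ex_radius e : 0 < e -> exists K, (K.+1%:R)^-1 <= e.
Proof.
move=> e0; exists (Num.bound e^-1).
rewrite -[leRHS]invrK lef_pV2 ?posrE ?invr_gt0 ?ltr0n //.
apply: le_trans (ltW (archi_boundP _)) _; first by rewrite invr_ge0 ltW.
by rewrite ler_nat.
Qed.

Lemma bnbhsP x (V : set (binseq R)) : nbhs x V <->
  exists K, forall y, (forall k, (k <= K)%N -> x k = y k) -> V y.
Proof.
rewrite -nbhs_ballE; split.
  move=> [e /= e0 eV]; have [K Ke] := ex_radius e0; exists K => y xy.
  apply: eV; apply: (le_ball Ke); exact/bball_agree.
move=> [K KV]; exists (K.+1%:R)^-1 => /=; first by rewrite invr_gt0 ltr0n.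
by move=> y /bball_agree; exact: KV.
Qed.

(** A Cauchy filter decides every coordinate, and neighbourhoods involve finitely many
    coordinates. *)
Lemma binseq_complete (F : set_system (binseq R)) : ProperFilter F -> cauchy F -> cvg F.
Proof.
move=> FF cF.
have /choice[l lP] : forall k, exists b, F [set y | y k = b].
  move=> k; have : entourage [set xy : binseq R * binseq R | xy.1 k = xy.2 k].
    rewrite -entourage_ballE; exists (k.+1%:R)^-1 => /=; first by rewrite invr_gt0 ltr0n.
    by move=> xy /bball_agree; exact.
  move=> /cF[[V W] /= [FV FW] VW].
  have [y Wy] := @filter_ex _ _ FF _ FW; exists (y k).
  by apply: filterS FV => x Vx; exact: (VW (x, y)).
apply/cvg_ex; exists (l : binseq R) => V /bnbhsP[K KV].
suff : F [set y | forall k, (k <= K)%N -> l k = y k] by apply: filterS => y; exact: KV.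
elim: K {KV} => [|K IH].
  by apply: filterS (lP 0%N) => y /= yl k; rewrite leqn0 => /eqP->.
apply: filterS (filterI IH (lP K.+1)) => y /= [h yl] k.
by rewrite leq_eqVlt => /predU1P[->//|]; rewrite ltnS; exact: h.
Qed.

HB.instance Definition _ := Uniform_isComplete.Build (binseq R) binseq_complete.

Lemma binseq_hausdorff : hausdorff_space (binseq R).
Proof.
move=> x y cxy; apply/funext => k.
have nb z : nbhs z [set z' : binseq R | z' k = z k].
  by apply/bnbhsP; exists k => z' h; apply/esym/h.
by have [z [/= <- <-]] := cxy _ _ (nb x) (nb y).
Qed.

Definition pad (s : seq bool) : binseq R := nth false s.

Lemma pad_mkseq x K : forall k, (k <= K)%N -> x k = pad (mkseq x K.+1) k.
Proof. by move=> k kK; rewrite /pad nth_mkseq. Qed.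

Lemma binseq_polish : polish (binseq R : completePseudoMetricType R).
Proof.
split; first exact: binseq_hausdorff.
exists (pad @` setT); first by apply: (sub_countable (card_image_le _ _)); exact: countableP.
move=> V [x Vx] oV; move: oV Vx; rewrite openE => h /h /bnbhsP[K KV].
exists (pad (mkseq x K.+1)); split; last by exists (mkseq x K.+1).
by apply: KV; exact: pad_mkseq.
Qed.

Variables (A : eqType) (b : nat -> A) (b' : A -> nat).
Hypotheses (bK : cancel b b') (b'K : cancel b' b).

Definition renumber (x : cube A) : binseq R := fun k => x (b k).

Definition unnumber (y : binseq R) : cube A := fun i => y (b' i).

Lemma renumberK : cancel renumber unnumber.
Proof. by move=> x; apply/funext => i; rewrite /renumber /unnumber b'K. Qed.

Lemma unnumberK : cancel unnumber renumber.
Proof. by move=> x; apply/funext => i; rewrite /renumber /unnumber bK. Qed.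

Lemma renumber_image (V : set (cube A)) : renumber @` V = unnumber @^-1` V.
Proof.
apply/seteqP; split => [_ [x Vx <-]|y Vy]; rewrite /preimage /= ?renumberK //.
by exists (unnumber y) => //; rewrite unnumberK.
Qed.

(** An open set is the union of the cylinders that it contains, and there are
    countably many cylinders. *)
Lemma cube_standard_borel : standard_borel R (cube A).
Proof.
exists (binseq R), renumber; split; first exact: binseq_polish.
  by exists unnumber; [exact: renumberK|exact: unnumberK].
move=> V; rewrite renumber_image; split.
  move=> mV; pose C := [set V : set (cube A) | <<s @open (binseq R) >> (unnumber @^-1` V)].
  have [s0 sC sU] := smallest_sigma_algebra setT (@open (binseq R)).
  suff : C V by [].
  apply: (smallest_sub _ _ mV).
    split; first by rewrite /C /= preimage_set0.
      by move=> W CW; rewrite /C /= -[unnumber @^-1` _]/(setT `\` (unnumber @^-1` W)); exact: sC.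
    by move=> W CW; rewrite /C /= preimage_bigcup; exact: sU.
  move=> _ [i _ <-]; apply: sub_gen_smallest; rewrite openE => y /= yi.
  by apply/bnbhsP; exists (b' i) => z /(_ _ (leqnn _)); rewrite /unnumber /= => <-.
pose C := [set W : set (binseq R) | measurable (renumber @^-1` W : set (cube A))].
move=> mV; have : C (unnumber @^-1` V).
  apply: (smallest_sub _ _ mV).
    split; first by rewrite /C /= preimage_set0.
      by move=> W CW; rewrite /C /= setTD; exact: measurableC CW.
    by move=> W CW; rewrite /C /= preimage_bigcup; apply: bigcup_measurable => k _; exact: CW.
  move=> W; rewrite openE => oW; rewrite /C /=.
  pose cylW (s : seq bool) := [set x : cube A |
     (forall y, (forall k, (k < size s)%N -> pad s k = y k) -> W y) /\
     (forall k, (k < size s)%N -> pad s k = x (b k))].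
  rewrite (_ : _ @^-1` _ = \bigcup_s cylW s).
    apply: countable_bigcupT_measurable; first exact: countableP.
    move=> s; apply: (@measurable_dep _ [seq b k | k <- iota 0 (size s)]) => x y xy [h1 h2].
    by split=> // k ks; rewrite h2 // xy // map_f // mem_iota.
  apply/seteqP; split => [x /= /oW /bnbhsP[K KW]|x [s _ [h1 h2]]]; last exact: h1.
  exists (mkseq (renumber x) K.+1) => //; split => [y h|k].
    apply: KW => k kK; rewrite (pad_mkseq (renumber x) kK); apply: h.
    by rewrite size_mkseq.
  by rewrite size_mkseq => kK; rewrite -pad_mkseq.
by rewrite /C /= (_ : _ @^-1` _ = V) //; apply/seteqP; split => x; rewrite /preimage /= renumberK.
Qed.

End BinSeq.

(** * The action *)

Lemma denumerable_bijection (A : Type) : countable [set: A] -> infinite_set [set: A] ->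
  exists (b : nat -> A) (b' : A -> nat), cancel b b' /\ cancel b' b.
Proof.
move=> cA /infiniteP iA.
have /card_set_bijP[f fbij] : ([set: A] #= [set: nat])%card.
  by apply/card_eqPle; split.
have [b b'K bK] : bijective f by rewrite -setTT_bijective.
by exists b, f.
Qed.

Theorem theorem0p1 (R : realType) (G : groupType)
    (G_countable : countable [set: G]) (G_infinite : infinite_set [set: G])
    (G_amenable : amenable R G) :
  exists (d : measure_display) (X : measurableType d) (mu : probability X R)
      (T : G -> X -> X),
    [/\ standard_borel R X, mp_action mu T, free_action mu T, mixing mu T &
        forall F : nat -> {fset G}, folner R F ->
          has_partition_entropies mu T F /\ ks_entropy mu T F = 0%E].
Proof.
pose I := (nat * G)%type.
have I_countable : countable [set: I].
  by rewrite -setXTT; apply: countableX => //; exact: countableP.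
have I_infinite : infinite_set [set: I].
  move=> finI; apply: G_infinite; rewrite (_ : [set: G] = snd @` [set: I]).
    exact: finite_image.
  by apply/seteqP; split => // g _; exists (0%N, g).
have [e [e' [_ e'K]]] := denumerable_bijection G_countable G_infinite.
have [b [b' [bK b'K]]] := denumerable_bijection I_countable I_infinite.
have [t] : inhabited (tower G) by apply: (exists_tower G_infinite (e := e)) => g; exists (e' g).
have Lam_ge0 (f : (I -> bool) -> R) : finitary f -> (forall x, 0 <= f x) -> 0 <= mean t f.
  by move=> /(finitary_stable t); exact: mean_ge0.
pose mu := law b b' (@mean R G t).
have muE (v : (I -> bool) -> bool) :
    finitary v -> mu [set x | v x] = (mean t (fun x => (v x)%:R))%:E.
  exact: (law_finitary bK b'K (@mean_lin R G t) Lam_ge0 (mean1 R t)).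
have ent F (FF : folner R F) k (P : 'I_k -> set (cube I)) (mP : measurable_partition P) :=
  mean_entropy_cvg0 muE FF mP.
exists _, (cube I), mu, (@gshift G); split.
- exact: cube_standard_borel bK b'K.
- exact: mp_shift muE.
- exact: free_shift muE G_infinite I_countable.
- exact: mixing_shift muE G_infinite.
- move=> F FF; split.
    by move=> k P mP; apply/cvg_ex; exists 0; exact: ent.
  have lim0 k (P : 'I_k -> set (cube I)) : measurable_partition P ->
      partition_entropy mu (@gshift G : G -> cube I -> cube I) F P = 0.
    by move=> mP; apply: cvg_lim => //; exact: ent.
  rewrite /ks_entropy (_ : [set h | _] = [set 0%E]) ?ereal_sup1 //.
  apply/seteqP; split => [h [k [P [mP ->]]]|_ ->]; first by rewrite /= lim0.
  have mP : measurable_partition (fun _ : 'I_1 => [set: cube I]).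
    split=> [|i]; last exact: measurableT.
    split.
    - by apply/seteqP; split => // x _; exists ord0.
    - by move=> i j _ _ _; rewrite !ord1.
    - by move=> i _; exists (fun=> false).
  by exists 1%N, (fun=> setT); split => //; rewrite lim0.
Qed.
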